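(* Let $\mathbf W$ be the AWGN channel with signal power $P>0$ and noise power $N>0$ (defined below). Then for all $\varepsilon,\delta,\mu,\lambda\ge0$ with $\varepsilon<1$, $\mu+\lambda<1$, $\delta<1$, $$C_s(\varepsilon,P|\mathbf W)=D(\mu,\lambda,P|\mathbf W)=S(\delta,P|\mathbf W)=C_s(P|\mathbf W)=\tfrac12\log\left(1+\tfrac PN\right).$$
   Context: The AWGN channel: input and output alphabets $\mathbb R$, memoryless with $W^n(\mathbf y|\mathbf x)=\prod_{i=1}^n\frac1{\sqrt{2\pi N}}e^{-(y_i-x_i)^2/(2N)}$ (density), cost $c_n(\mathbf x)=x_1^2+\cdots+x_n^2$, and cost level $\Gamma=P$, so $\mathcal X^n(P)=\{\mathbf x\in\mathbb R^n:\frac1n\sum x_i^2\le P\}$. $\mathcal S_P$ is the set of input processes $\mathbf X=\{X^n\}$ with $\Pr\{X^n\in\mathcal X^n(P)\}=1$ for all $n$; $Y^n$ is the channel output for input $X^n$. For a distribution $Q$ on $\mathbb R^n$, $QW^n(B)=\int W^n(B|\mathbf x)Q(d\mathbf x)$. Transmission codes: an $(n,M_n,\varepsilon_n,P)$ code is an encoder $\varphi_n:\{1,\dots,M_n\}\to\mathcal X^n(P)$ and a decoder $\psi_n:\mathbb R^n\to\{1,\dots,M_n\}$, with $\varepsilon_n=\frac1{M_n}\sum_iW^n(\mathcal D_i^c|\varphi_n(i))$, $\mathcal D_i=\psi_n^{-1}(i)$. $R$ is $(\varepsilon,P)$-achievable if such codes exist with $\limsup\varepsilon_n\le\varepsilon$,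 $\liminf\frac1n\log M_n\ge R$; $C_s(\varepsilon,P|\mathbf W)$ is the supremum of such $R$, $C_s(P|\mathbf W)=C_s(0,P|\mathbf W)$. Identification codes: an $(n,N_n,\mu_n,\lambda_n,P)$ code consists of distributions $Q_1,\dots,Q_{N_n}$ with $Q_i(\mathcal X^n(P))=1$ and (not necessarily disjoint) sets $\mathcal D_1,\dots,\mathcal D_{N_n}\subset\mathbb R^n$, with $\mu_n=\max_iQ_iW^n(\mathcal D_i^c)$, $\lambda_n=\max_{i\ne j}Q_jW^n(\mathcal D_i)$. $R$ is $(\mu,\lambda,P)$-achievable if such codes exist with $\limsup\mu_n\le\mu$, $\limsup\lambda_n\le\lambda$, $\liminf\frac1n\log\log N_n\ge R$; $D(\mu,\lambda,P|\mathbf W)$ is the supremum of such $R$. Resolvability: $d(P_1,P_2)=2\sup_B|P_1(B)-P_2(B)|$; $U_M$ is uniform on $\{1,\dots,M\}$. For $\mathbf X\in\mathcal S_P$, $R$ is $(\delta,P)$-achievable for $\mathbf X$ if there are $M_n$ and maps $\varphi_n:\{1,\dots,M_n\}\to\mathcal X^n(P)$ such that, with $\tilde Y^n$ the output for input $\varphi_n(U_{M_n})$, $\limsup d(P_{Y^n},P_{\tilde Y^n})\le\delta$ and $\limsup\frac1n\log M_n\le R$. $R$ is $(\delta,P)$-achievable if so for all $\mathbf X\in\mathcal S_P$; $S(\delta,P|\mathbf W)$ is the infimum of such $R$. *)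

(* Defs.v *)
From HB Require Import structures.
From mathcomp Require Import all_boot all_order all_algebra.
From mathcomp Require Import all_classical all_reals all_analysis.

Unset Printing Implicit Defensive.

Import Order.TTheory GRing.Theory Num.Theory.
Local Open Scope classical_set_scope.
Local Open Scope ring_scope.

Section awgn.
Context {R : realType}.

Definition gauss (N x y : R) : R :=
  (Num.sqrt (2 * pi * N))^-1 * expR (- (y - x) ^+ 2 / (2 * N)).

(* R^n is represented by n.-tuple R, with its canonical product
   sigma-algebra (generated by the coordinate maps). *)

(* W^n(B | x) = \int_B prod_i gauss N x_i y_i dy, written as iterated
   integrals (Tonelli) against Lebesgue measure on R, coordinate by
   coordinate. *)
Fixpoint Wn (N : R) {n : nat} : n.-tuple R -> set (n.-tuple R) -> \bar R :=
  match n return n.-tuple R -> set (n.-tuple R) -> \bar R with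
  | 0 => fun x B => (\1_B x)%:E
  | n'.+1 => fun x B =>
      (\int[@lebesgue_measure R]_(y in setT)
         ((gauss N (thead x) y)%:E *
          Wn N [tuple of behead x] [set t : n'.-tuple R | B (cons_tuple (y : R) t)]))%E
  end.

Definition Xn (P : R) (n : nat) : set (n.-tuple R) :=
  [set x | (n%:R)^-1 * \sum_(i < n) (tnth x i) ^+ 2 <= P].

Definition QW (N : R) {n : nat} (Q : probability (n.-tuple R) R)
  (B : set (n.-tuple R)) : \bar R :=
  (\int[Q]_x Wn N x B)%E.

Local Open Scope ereal_scope.

Definition is_tcode (P : R) {n M : nat} (enc : 'I_M -> n.-tuple R)
  (dec : n.-tuple R -> 'I_M) : Prop :=
  (forall i, Xn P n (enc i)) /\ (forall i, measurable (dec @^-1` [set i])).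

Definition tcode_err (N : R) {n M : nat} (enc : 'I_M -> n.-tuple R)
  (dec : n.-tuple R -> 'I_M) : \bar R :=
  ((M%:R)^-1)%:E * \sum_(i < M) Wn N (enc i) (~` (dec @^-1` [set i])).

Definition tcode_achievable (N P eps r : R) : Prop :=
  exists (M : nat -> nat) (enc : forall n, 'I_(M n) -> n.-tuple R)
         (dec : forall n, n.-tuple R -> 'I_(M n)),
    (forall n, is_tcode P (enc n) (dec n)) /\
    limn_esup (fun n => tcode_err N (enc n) (dec n)) <= eps%:E /\
    r%:E <= limn_einf (fun n => ((n%:R)^-1 * ln (M n)%:R)%:E).

Definition Cs (N P eps : R) : \bar R :=
  ereal_sup [set r%:E | r in [set r | tcode_achievable N P eps r]].

Definition is_idcode (P : R) {n K : nat}
  (Q : 'I_K -> probability (n.-tuple R) R) (D : 'I_K -> set (n.-tuple R)) : Prop :=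
  (forall i, Q i (Xn P n) = 1) /\ (forall i, measurable (D i)).

Definition id_mu (N : R) {n K : nat}
  (Q : 'I_K -> probability (n.-tuple R) R) (D : 'I_K -> set (n.-tuple R)) : \bar R :=
  \big[Order.max/0]_(i < K) QW N (Q i) (~` D i).

Definition id_lambda (N : R) {n K : nat}
  (Q : 'I_K -> probability (n.-tuple R) R) (D : 'I_K -> set (n.-tuple R)) : \bar R :=
  \big[Order.max/0]_(i < K) \big[Order.max/0]_(j < K | j != i) QW N (Q j) (D i).

Definition idcode_achievable (N P mu lam r : R) : Prop :=
  exists (K : nat -> nat)
         (Q : forall n, 'I_(K n) -> probability (n.-tuple R) R)
         (D : forall n, 'I_(K n) -> set (n.-tuple R)),
    (forall n, (1 <= K n)%N) /\
    (forall n, is_idcode P (Q n) (D n)) /\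
    limn_esup (fun n => id_mu N (Q n) (D n)) <= mu%:E /\
    limn_esup (fun n => id_lambda N (Q n) (D n)) <= lam%:E /\
    r%:E <= limn_einf (fun n => ((n%:R)^-1 * ln (ln (K n)%:R))%:E).

Definition Did (N P mu lam : R) : \bar R :=
  ereal_sup [set r%:E | r in [set r | idcode_achievable N P mu lam r]].

Definition vdist {n : nat} (P1 P2 : set (n.-tuple R) -> \bar R) : \bar R :=
  2%:E * ereal_sup [set `|P1 B - P2 B| | B in [set B | measurable B]].

(* input processes in S_P, given by the distributions of the X^n *)
Definition input_process (P : R) (X : forall n, probability (n.-tuple R) R) : Prop :=
  forall n, X n (Xn P n) = 1.

Definition unif_out (N : R) {n M : nat} (phi : 'I_M -> n.-tuple R)
  (B : set (n.-tuple R)) : \bar R :=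
  ((M%:R)^-1)%:E * \sum_(i < M) Wn N (phi i) B.

Definition res_achievable_for (N P delta r : R)
  (X : forall n, probability (n.-tuple R) R) : Prop :=
  exists (M : nat -> nat) (phi : forall n, 'I_(M n) -> n.-tuple R),
    (forall n, (0 < M n)%N) /\
    (forall n i, Xn P n (phi n i)) /\
    limn_esup (fun n => vdist (QW N (X n)) (unif_out N (phi n))) <= delta%:E /\
    limn_esup (fun n => ((n%:R)^-1 * ln (M n)%:R)%:E) <= r%:E.

Definition res_achievable (N P delta r : R) : Prop :=
  forall X, input_process P X -> res_achievable_for N P delta r X.

Definition Sres (N P delta : R) : \bar R :=
  ereal_inf [set r%:E | r in [set r | res_achievable N P delta r]].

End awgn.

(* Main.v *)
(* Write i(x;y) for the log-density of the channel output law of input x with respect to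
   the iid Gaussian law of variance P + N. All exponential moments of i are explicit
   Gaussian integrals, which gives Chernoff bounds: i(x;Y) <= n (C + g) with exponentially
   high probability for every x with |x|^2 <= n P, and i(X;Y) >= n (C' - g) for a Gaussian
   input of variance P' < P and its capacity C'.

   The upper tail yields the strong converse for transmission (change of measure to the
   Gaussian output law) and the soft covering lemma: every admissible input law is
   simulated by exp(n (C + g)) points, chosen one at a time so that the L2 norm of the error
   of the truncated densities grows like in Maurey's lemma. Hence S <= C. The lower tail
   yields transmission codes of rate below C by Feinstein's greedy argument, and from those
   identification codes by a Gilbert-Varshamov choice of subsets of codewords. Hence
   C <= C_s and C <= D.

   Finally D <= S whenever mu + lambda + delta < 1: up to quantizing the inputs, which
   changes output laws little in total variation, there are only exp(poly(n) M)
   resolvability codes of size M, and two identification messages with the same quantized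
   resolvability code would be confused. *)
Require Import Defs.
From HB Require Import structures.
From mathcomp Require Import all_boot all_order all_algebra.
From mathcomp Require Import all_classical all_reals all_analysis.
From mathcomp Require Import measurable_realfun ring lra.

Set Implicit Arguments.
Unset Strict Implicit.
Unset Printing Implicit Defensive.

Import Order.TTheory GRing.Theory Num.Theory.
Import numFieldNormedType.Exports.
Local Open Scope classical_set_scope.
Local Open Scope ring_scope.

(** * Gaussian integrals on the line *)

(** The exponential moments of i(x;Y) depend on x only through its energy, so for the upper tail the
    power constraint alone gives a bound uniform in x. The lower tail has no such uniformity, as an
    input of low energy carries little information: it is averaged over a Gaussian input, whose
    variance stays below P because that input must meet the power constraint with high probability.

    Two obstacles come from the continuous alphabets. The peak of a channel density can lie far
    above exp(n C), hence the truncation before any L2 estimate. Codes are uncountably many, hence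
    the quantization; the factor of order n^3 that it puts beside M is invisible to log log.

    The inequality D <= S is used twice: with delta = 0 it gives D(mu, lambda) <= S(0) <= C, and
    with mu = lambda = 0 it gives C <= D(0, 0) <= S(delta). Therefore the separate conditions mu +
    lambda < 1 and delta < 1 suffice. The threshold for delta is 1 since the distance carries a
    factor 2: two codes, each at distance delta, shift a probability by delta in all. *)

Section density.
Context d (T : measurableType d) (R : realType).
Variables (mu nu : {measure set T -> \bar R}) (h : T -> R).
Hypotheses (mh : measurable_fun setT h) (h0 : forall x, 0 <= h x).
Hypothesis nuE : forall B, measurable B -> nu B = (\int[mu]_(x in B) (h x)%:E)%E.
Local Open Scope ereal_scope.
Import HBNNSimple.

Lemma ge0_integral_density (f : T -> \bar R) :
  measurable_fun setT f -> (forall x, 0 <= f x) ->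
  \int[nu]_x f x = \int[mu]_x (f x * (h x)%:E).
Proof.
move=> mf f0.
pose f_ := nnsfun_approx measurableT mf.
have mh' : measurable_fun setT (EFin \o h) by exact/measurable_EFinP.
transitivity (limn (fun n => \int[nu]_x (f_ n x)%:E)).
  rewrite -monotone_convergence//.
  - apply: eq_integral => y _; apply/esym/cvg_lim => //.
    by apply: cvg_nnsfun_approx.
  - by move=> n; exact/measurable_EFinP/measurable_funP.
  - by move=> n y _; rewrite lee_fin.
  - by move=> y _ m n mn; rewrite lee_fin; exact/lefP/nd_nnsfun_approx.
rewrite [X in limn X](_ : _ = fun n => \int[mu]_x ((f_ n x)%:E * (h x)%:E)); last first.
  apply/funext => n.
  transitivity (\sum_(k \in range (f_ n)) (k%:E * nu (f_ n @^-1` [set k]))).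
    by rewrite integralT_nnsfun sintegralE; apply: eq_fsbigr.
  transitivity (\sum_(k \in range (f_ n))
      \int[mu]_x ((k * \1_(f_ n @^-1` [set k]) x)%:E * (h x)%:E)).
    apply: eq_fsbigr => k /[1!inE] -[t _ tk].
    have k0 : (0 <= k)%R by rewrite -tk.
    rewrite nuE// [in LHS]integral_mkcond/= -ge0_integralZl_EFin//; last 2 first.
    - by move=> x _; rewrite patchE; case: ifP => // _; rewrite lee_fin.
    - by apply/(measurable_restrictT _ _).1 => //; exact: measurable_funTS.
    apply: eq_integral => x _; rewrite patchE indicE.
    by case: ifPn => _; rewrite ?mulr1 ?mulr0 ?mule0 ?mul0e.
  rewrite -ge0_integral_fsum//; last 2 first.
  - by move=> k; apply: emeasurable_funM => //; exact/measurable_EFinP/measurable_funM.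
  - by move=> k x _; rewrite mule_ge0 ?lee_fin// -lee_fin EFinM nnfun_muleindic_ge0.
  apply: eq_integral => x _.
  rewrite -ge0_mule_fsuml; last by move=> k; rewrite EFinM nnfun_muleindic_ge0.
  by rewrite fsumEFin// -fimfunE.
rewrite -monotone_convergence//.
- apply: eq_integral => y _; apply/cvg_lim => //.
  by apply: cvgeZr => //; apply: cvg_nnsfun_approx.
- by move=> n; apply: emeasurable_funM => //; exact/measurable_EFinP/measurable_funP.
- by move=> n y _; rewrite mule_ge0// lee_fin.
- move=> y _ m n mn; rewrite lee_wpmul2r ?lee_fin//.
  exact/lefP/nd_nnsfun_approx.
Qed.

End density.

Section gauss1.
Context {R : realType}.
Implicit Types (x y s : R).
Notation mu := (@lebesgue_measure R).

Lemma normal_pdf_exp x s y : 0 < s ->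
  normal_pdf x s y = expR (- ln (Num.sqrt (2 * pi)) - ln s - (y - x) ^+ 2 / (2 * s ^+ 2)).
Proof.
move=> s0; rewrite normal_pdfE ?gt_eqF// /normal_peak /normal_fun.
have p0 : 0 < Num.sqrt (2 * pi) :> R by rewrite sqrtr_gt0 mulr_gt0 ?pi_gt0.
rewrite expRD expRB expRN !lnK//; congr (_ * expR _); last first.
  by rewrite -[s ^+ 2 *+ 2]mulr_natl mulNr.
rewrite -invfM -[_ *+ 2]mulr_natr -mulrA sqrtrM ?sqr_ge0// sqrtr_sqr gtr0_norm//.
by rewrite [pi * 2]mulrC [s * _]mulrC.
Qed.

Lemma integral_normal_probE x s (f : R -> \bar R) : measurable_fun setT f ->
  (forall y, 0 <= f y)%E ->
  (\int[normal_prob x s]_y f y = \int[mu]_y (f y * (normal_pdf x s y)%:E))%E.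
Proof.
move=> mf f0; apply: ge0_integral_density => //.
exact: measurable_normal_pdf.
by move=> y; exact: normal_pdf_ge0.
Qed.

Lemma integral_normal_exp x s (a b c : R) : 0 < s -> 0 < 1 - 2 * a * s ^+ 2 ->
  (\int[normal_prob x s]_y (expR (a * (y - x) ^+ 2 + b * (y - x) + c))%:E =
  (expR (c + b ^+ 2 * s ^+ 2 / (2 * (1 - 2 * a * s ^+ 2))
    - 2^-1 * ln (1 - 2 * a * s ^+ 2)))%:E)%E.
Proof.
move=> s0 k0; set k := 1 - _ in k0 *.
have me : measurable_fun setT (fun y => (expR (a * (y - x) ^+ 2 + b * (y - x) + c))).
  apply: measurableT_comp => //; apply: measurable_funD => //.
  apply: measurable_funD => //; apply: measurable_funM => //.
    by apply: measurable_funX => //; exact: measurable_funB.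
  exact: measurable_funB.
rewrite integral_normal_probE//; last exact/measurable_EFinP.
have q0 : 0 < Num.sqrt k by rewrite sqrtr_gt0.
(* Completing the square: the integrand times the density of (x, s) is a constant, the right-hand
   side, times the normal density of mean [m] and standard deviation [s'], whose integral is 1. *)
pose s' := s / Num.sqrt k; pose m := x + b * s ^+ 2 / k.
have s'0 : 0 < s' by rewrite divr_gt0.
rewrite -[RHS]mule1 -(integral_normal_pdf m s').
rewrite -ge0_integralZl_EFin ?expR_ge0//; last 2 first.
- by move=> y _; rewrite lee_fin normal_pdf_ge0.
- by apply/measurable_EFinP; exact: measurable_normal_pdf.
apply: eq_integral => y _; rewrite -!EFinM; congr (_%:E).
rewrite !normal_pdf_exp// -!expRD; congr expR.
have -> : ln s' = ln s - 2^-1 * ln k.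
  rewrite lnM ?posrE ?invr_gt0// lnV ?posrE//; congr (_ - _).
  rewrite -[in RHS](sqr_sqrtr (ltW k0)) expr2 lnM ?posrE//.
  by lra.
rewrite /s' expr_div_n sqr_sqrtr ?(ltW k0)// /m /k.
field; rewrite /k in k0; rewrite -/k !gt_eqF//.
Qed.

End gauss1.

(** * Gaussian product measures on tuples *)

Section gausst.
Context {R : realType}.
Implicit Types (s : R).

Definition consp n (u : R * n.-tuple R) : n.+1.-tuple R := [tuple of u.1 :: u.2].

Lemma measurable_consp n : measurable_fun setT (@consp n).
Proof. exact: measurable_cons. Qed.

HB.instance Definition _ n := isMeasurableFun.Build _ _ _ _ (@consp n) (@measurable_consp n).

Definition tbehead n (x : n.+1.-tuple R) : n.-tuple R := [tuple of behead x].

Lemma consp_eta n (x : n.+1.-tuple R) : consp (thead x, tbehead x) = x.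
Proof. by rewrite [RHS]tuple_eta; exact: val_inj. Qed.

Lemma tnth_consp0 n u : tnth (@consp n u) ord0 = u.1.
Proof. by rewrite (tnth_nth 0). Qed.

Lemma tnth_consp n u (i : 'I_n) : tnth (@consp n u) (lift ord0 i) = tnth u.2 i.
Proof. by rewrite !(tnth_nth 0). Qed.

Lemma tnth_tbehead n (x : n.+1.-tuple R) (i : 'I_n) : tnth (tbehead x) i = tnth x (lift ord0 i).
Proof. by rewrite -{2}(consp_eta x) tnth_consp. Qed.

Definition idR (x : measurableTypeR R) : R := x.

Lemma measurable_idR : measurable_fun setT idR.
Proof. by move=> _ B mB; rewrite setTI. Qed.

HB.instance Definition _ := isMeasurableFun.Build _ _ _ _ idR measurable_idR.

(* The library puts normal_prob on measurableTypeR R, whereas n.-tuple R refers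
   to the measurable structure carried by R itself. *)
Definition normalR (x s : R) : probability R R :=
  distribution (normal_prob x s) idR.

Lemma ge0_integral_normalR (x s : R) (f : R -> \bar R) :
  measurable_fun setT f -> (forall y, 0 <= f y)%E ->
  (\int[normalR x s]_y f y = \int[normal_prob x s]_y f y)%E.
Proof. by move=> mf f0; rewrite [LHS]ge0_integral_pushforward. Qed.

Definition gaussS s n (x : n.+1.-tuple R) (G : probability (n.-tuple R) R) :
    probability (n.+1.-tuple R) R :=
  distribution (normalR (thead x) s \x G)%E (@consp n).

(** The recursion of [Wn], carried out on probability measures. The standard deviation is free
    because the Gaussian input and output laws are built by the same recursion. *)
Fixpoint gausst s {n : nat} : n.-tuple R -> probability (n.-tuple R) R :=
  match n return n.-tuple R -> probability (n.-tuple R) R with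
  | 0 => fun x => \d_x
  | n'.+1 => fun x => @gaussS s n' x (gausst s (tbehead x))
  end.

Local Open Scope ereal_scope.

Lemma measurable_consp2 n (y0 : R) : measurable_fun setT (fun y : n.-tuple R => consp (y0, y)).
Proof. by apply: measurableT_comp => //; exact: measurable_consp. Qed.

Lemma ge0_integral_gausstS s n (x : n.+1.-tuple R) (f : n.+1.-tuple R -> \bar R) :
  measurable_fun setT f -> (forall y, 0 <= f y) ->
  \int[gausst s x]_y f y =
  \int[normalR (thead x) s]_y0 \int[gausst s (tbehead x)]_y f (consp (y0, y)).
Proof.
move=> mf f0; rewrite [LHS]ge0_integral_pushforward//.
rewrite preimage_setT (fubini_tonelli1 (f \o @consp n))//.
- by apply: measurableT_comp => //; exact: measurable_consp.
- by move=> u; exact: f0.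
Qed.

Lemma measurable_integral_consp s n (x : n.-tuple R) (f : n.+1.-tuple R -> \bar R) :
  measurable_fun setT f -> (forall y, 0 <= f y) ->
  measurable_fun setT (fun y0 => \int[gausst s x]_y f (consp (y0, y))).
Proof.
move=> mf f0.
apply: (measurable_fun_fubini_tonelli_F (f \o @consp n)) => //.
- by apply: measurableT_comp => //; exact: measurable_consp.
- by move=> u; exact: f0.
Qed.

Lemma gauss_normal_pdf N (x y : R) : (0 < N)%R -> gauss N x y = normal_pdf x (Num.sqrt N) y.
Proof.
move=> N0; rewrite normal_pdfE ?gt_eqF ?sqrtr_gt0// /normal_peak /normal_fun /gauss.
rewrite sqr_sqrtr ?ltW//; congr ((Num.sqrt _)^-1 * expR (_ / _))%R; ring.
Qed.

(** [Wn] is only a set function; through this identity it inherits the properties of a probability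
    measure. Both sides peel off the first coordinate, the right one by Tonelli. *)
Lemma WnE N n (x : n.-tuple R) B : (0 < N)%R -> measurable B ->
  Wn N x B = gausst (Num.sqrt N) x B.
Proof.
move=> N0; elim: n x B => [|n IH] x B mB; first by rewrite /= diracE indicE.
have mI : measurable_fun setT (fun y => (\1_B y)%:E : \bar R).
  by apply/measurable_EFinP; exact: measurable_indic.
have mI0 y : 0 <= (\1_B y)%:E :> \bar R by rewrite lee_fin.
rewrite -[in RHS](setIT B) -integral_indic// ge0_integral_gausstS//.
have mF := measurable_integral_consp (Num.sqrt N) (tbehead x) mI (fun y => mI0 y).
rewrite ge0_integral_normalR; last 2 first.
- exact: mF.
- by move=> y; exact: integral_ge0.
rewrite integral_normal_probE; last 2 first.
- exact: mF.
- by move=> y; exact: integral_ge0.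
apply: eq_integral => y _; rewrite gauss_normal_pdf// muleC; congr (_ * _).
have mBy : measurable [set t | B (consp (y, t))].
  by rewrite -[X in measurable X]setTI; exact: measurable_consp2.
rewrite -[LHS]/(Wn N (tbehead x) [set t | B (consp (y, t))]) IH//.
by rewrite -[X in gausst _ _ X]setIT -integral_indic.
Qed.

Lemma measurable_tuple_sum n (g : 'I_n -> R -> R) : (forall i, measurable_fun setT (g i)) ->
  measurable_fun setT (fun y : n.-tuple R => \sum_(i < n) g i (tnth y i))%R.
Proof.
move=> mg; apply: measurable_sum => i; apply: measurableT_comp => //.
exact: measurable_tnth.
Qed.

Lemma measurable_tuple_sum2 n (g : R -> R -> R) :
  measurable_fun setT (fun u : R * R => g u.1 u.2) ->
  measurable_fun setT (fun u : n.-tuple R * n.-tuple R =>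
    \sum_(i < n) g (tnth u.1 i) (tnth u.2 i))%R.
Proof.
move=> mg; apply: measurable_sum => i.
have m1 : measurable_fun setT (fun u : n.-tuple R * n.-tuple R => tnth u.1 i).
  by apply: (measurableT_comp (measurable_tnth i)).
have m2 : measurable_fun setT (fun u : n.-tuple R * n.-tuple R => tnth u.2 i).
  by apply: (measurableT_comp (measurable_tnth i)).
exact: (measurableT_comp mg (measurable_fun_pair m1 m2)).
Qed.

(** Independence of the coordinates: the exponential moment of a sum factorizes. Each factor is
    recorded by its logarithm [h i], so that products of Gaussian integrals become sums of
    exponents. *)
Lemma integral_gausst_exp s n (x : n.-tuple R) (g : 'I_n -> R -> R) (h : 'I_n -> R) :
  (forall i, measurable_fun setT (g i)) ->
  (forall i, \int[normalR (tnth x i) s]_y (expR (g i y))%:E = (expR (h i))%:E) ->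
  \int[gausst s x]_y (expR (\sum_(i < n) g i (tnth y i)))%:E = (expR (\sum_(i < n) h i))%:E.
Proof.
have mT m (g' : 'I_m -> R -> R) : (forall i, measurable_fun setT (g' i)) ->
    measurable_fun setT (fun y : m.-tuple R => (expR (\sum_(i < m) g' i (tnth y i)))%:E).
  move=> mg; apply/measurable_EFinP; apply: measurableT_comp => //.
  exact: measurable_tuple_sum.
elim: n x g h => [|n IH] x g h mg hE.
  by rewrite (integral_dirac x measurableT (mT 0%N g mg)) diracE in_setT mul1e !big_ord0.
rewrite (ge0_integral_gausstS s x (mT _ _ mg))//.
pose g' i := g (lift ord0 i); pose h' i := h (lift ord0 i).
have mg' i : measurable_fun setT (g' i) by exact: mg.
transitivity (\int[normalR (thead x) s]_y
    ((expR (g ord0 y))%:E * (expR (\sum_(i < n) h' i))%:E)).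
  apply: eq_integral => y0 _; rewrite -(IH (tbehead x) g' h' mg'); last first.
    by move=> i; rewrite tnth_tbehead hE.
  rewrite -ge0_integralZl_EFin ?expR_ge0//; last exact: mT.
  apply: eq_integral => y _; rewrite -EFinM -expRD big_ord_recl tnth_consp0.
  by congr (expR (_ + _))%:E; apply: eq_bigr => i _; rewrite tnth_consp.
rewrite ge0_integralZr ?lee_fin ?expR_ge0//; last first.
  by apply/measurable_EFinP; apply: measurableT_comp.
by rewrite hE -EFinM -expRD big_ord_recl.
Qed.

(** The log-likelihood ratio at y of the normal law of mean x and deviation s against that of mean
    x' and deviation s'. *)
Definition llr (s s' x x' y : R) : R :=
  ln s' - ln s - (y - x) ^+ 2 / (2 * s ^+ 2) + (y - x') ^+ 2 / (2 * s' ^+ 2).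

Lemma measurable_llr s s' x x' : measurable_fun setT (llr s s' x x').
Proof.
have mq c t : measurable_fun setT (fun y : R => (y - c) ^+ 2 / t)%R.
  by apply: measurable_funM => //; apply: measurable_funX => //; exact: measurable_funB.
by apply: measurable_funD => //; apply: measurable_funB.
Qed.

Lemma integral_normalR_llr s s' x x' (f : R -> \bar R) : (0 < s)%R -> (0 < s')%R ->
  measurable_fun setT f -> (forall y, 0 <= f y) ->
  \int[normalR x s]_y f y = \int[normalR x' s']_y (f y * (expR (llr s s' x x' y))%:E).
Proof.
move=> s0 s'0 mf f0.
have me : measurable_fun setT (fun y : R => (expR (llr s s' x x' y))%:E).
  by apply/measurable_EFinP; apply: measurableT_comp => //; exact: measurable_llr.
have fe0 y : 0 <= f y * (expR (llr s s' x x' y))%:E by rewrite mule_ge0// lee_fin expR_ge0.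
have mfe : measurable_fun setT (fun y : R => f y * (expR (llr s s' x x' y))%:E).
  exact: emeasurable_funM.
rewrite (ge0_integral_normalR _ _ mf f0) (ge0_integral_normalR _ _ mfe fe0).
rewrite (integral_normal_probE _ _ mf f0) (integral_normal_probE _ _ mfe fe0).
apply: eq_integral => y _; rewrite -muleA; congr (_ * _).
rewrite -EFinM !normal_pdf_exp// -expRD /llr; congr (expR _)%:E; ring.
Qed.

Lemma integral_gausst_llr s s' n (x x' : n.-tuple R) (f : n.-tuple R -> \bar R) :
  (0 < s)%R -> (0 < s')%R -> measurable_fun setT f -> (forall y, 0 <= f y) ->
  \int[gausst s x]_y f y = \int[gausst s' x']_y (f y *
     (expR (\sum_(i < n) llr s s' (tnth x i) (tnth x' i) (tnth y i)))%:E).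
Proof.
move=> s0 s'0.
have ml n' (z z' : n'.-tuple R) : measurable_fun setT (fun y : n'.-tuple R =>
   (expR (\sum_(i < n') llr s s' (tnth z i) (tnth z' i) (tnth y i)))%:E).
  apply/measurable_EFinP; apply: measurableT_comp => //.
  apply: (@measurable_tuple_sum _ (fun i => llr s s' (tnth z i) (tnth z' i))) => i.
  exact: measurable_llr.
elim: n x x' f => [|n IH] x x' f mf f0.
  rewrite [RHS](eq_integral f); last by move=> y _; rewrite big_ord0 expR0 mule1.
  by rewrite (tuple0 x) (tuple0 x').
pose e y := (expR (\sum_(i < n.+1) llr s s' (tnth x i) (tnth x' i) (tnth y i)))%:E.
have mfe : measurable_fun setT (fun y => f y * e y) := emeasurable_funM mf (ml n.+1 x x').
have e0 m (z : 'I_m -> R) : 0 <= (expR (\sum_(i < m) z i))%:E by rewrite lee_fin expR_ge0.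
have fe0 y : 0 <= f y * e y := mule_ge0 (f0 y) (e0 _ _).
rewrite [LHS](ge0_integral_gausstS s x mf f0) [RHS](ge0_integral_gausstS s' x' mfe fe0).
have mf2 y0 : measurable_fun setT (fun y => f (consp (y0, y))).
  by apply: (measurableT_comp mf); exact: measurable_consp2.
rewrite [LHS](integral_normalR_llr (thead x) (thead x') s0 s'0); last 2 first.
- exact: measurable_integral_consp.
- by move=> y; exact: integral_ge0.
apply: eq_integral => y0 _.
rewrite (IH _ (tbehead x') _ (mf2 y0) (fun y => f0 _)).
rewrite -ge0_integralZr ?lee_fin ?expR_ge0//; last 2 first.
- exact: (emeasurable_funM (mf2 y0) (ml n _ _)).
- by move=> y _; exact: (mule_ge0 (f0 _) (e0 _ _)).
rewrite /e; apply: eq_integral => y _; rewrite -muleA -EFinM -expRD; congr (_ * (expR _)%:E).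
rewrite big_ord_recl tnth_consp0 addrC; congr (_ + _)%R.
by apply: eq_bigr => i _; rewrite tnth_consp !tnth_tbehead.
Qed.

End gausst.

(** * Moment generating functions of the information density *)

Section real_facts.
Context {R : realType}.
Implicit Types a b u : R.

Lemma ln_sqrt a : 0 < a -> ln (Num.sqrt a) = 2^-1 * ln a.
Proof.
move=> a0; have q0 : 0 < Num.sqrt a by rewrite sqrtr_gt0.
by rewrite -[in RHS](sqr_sqrtr (ltW a0)) expr2 lnM ?posrE//; lra.
Qed.

Lemma ln_le_sub1 a : 0 < a -> ln a <= a - 1.
Proof.
move=> a0; have := expR_ge1Dx (ln a); rewrite lnK ?posrE//; lra.
Qed.

Lemma ln_ge_1subV a : 0 < a -> 1 - a^-1 <= ln a.
Proof.
move=> a0; have := @ln_le_sub1 a^-1; rewrite invr_gt0 lnV ?posrE// => /(_ a0); lra.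
Qed.

End real_facts.

Section gauss_mgf.
Context {R : realType}.
Variables (P N : R).
Hypotheses (P0 : 0 < P) (N0 : 0 < N).
Let S := P + N.

Let S0 : 0 < S. Proof. by rewrite addr_gt0. Qed.

Definition capacity : R := 2^-1 * ln (1 + P / N).

Lemma capacityE : capacity = 2^-1 * (ln S - ln N).
Proof. by rewrite /capacity -lnV ?posrE// -lnM ?posrE ?invr_gt0// mulrDl divff ?gt_eqF// addrC. Qed.

Definition idens1 (x y : R) : R := llr (Num.sqrt N) (Num.sqrt S) x 0 y.

Lemma idens1E x y : idens1 x y = capacity - (y - x) ^+ 2 / (2 * N) + y ^+ 2 / (2 * S).
Proof.
by rewrite /idens1 /llr !ln_sqrt// !sqr_sqrtr ?ltW// subr0 capacityE; ring.
Qed.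

Lemma normalR_exp x s (a b c : R) (g : R -> R) r : 0 < s -> 0 < 1 - 2 * a * s ->
  (forall y, g y = a * (y - x) ^+ 2 + b * (y - x) + c) ->
  c + b ^+ 2 * s / (2 * (1 - 2 * a * s)) - 2^-1 * ln (1 - 2 * a * s) = r ->
  (\int[normalR x (Num.sqrt s)]_y (expR (g y))%:E = (expR r)%:E)%E.
Proof.
move=> s0 k0 gE <-.
have s2 : Num.sqrt s ^+ 2 = s by rewrite sqr_sqrtr ?ltW.
have mg : measurable_fun setT (fun y => (expR (g y))%:E).
  under eq_fun do rewrite gE.
  apply/measurable_EFinP; apply: measurableT_comp => //; apply: measurable_funD => //.
  apply: measurable_funD => //; apply: measurable_funM => //.
    by apply: measurable_funX => //; exact: measurable_funB.
  exact: measurable_funB.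
rewrite (ge0_integral_normalR _ _ mg)//.
under eq_integral do rewrite gE.
by rewrite integral_normal_exp ?sqrtr_gt0 ?s2.
Qed.

(** Both signs of [s] matter: positive values serve the upper tail, negative ones the lower tail.
    Positivity of [S + s * P] is exactly the convergence of the Gaussian integral. *)
Lemma idens1_mgf s x : 0 < S + s * P ->
  (\int[normalR x (Num.sqrt N)]_y (expR (s * idens1 x y))%:E =
   (expR (s * capacity + s * (1 + s) * x ^+ 2 / (2 * (S + s * P))
      - 2^-1 * ln (1 + s * P / S)))%:E)%E.
Proof.
move=> sP.
have aE : 1 - 2 * (s / (2 * S) - s / (2 * N)) * N = 1 + s * P / S.
  by rewrite /S; field; rewrite -/S !gt_eqF.
have k0 : 0 < 1 + s * P / S.
  by rewrite -(divff (lt0r_neq0 S0)) -mulrDl divr_gt0.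
apply: (@normalR_exp x N (s / (2 * S) - s / (2 * N)) (s * x / S)
   (s * x ^+ 2 / (2 * S) + s * capacity)) => //.
- by rewrite aE.
- by move=> y; rewrite idens1E; field; rewrite !gt_eqF.
- rewrite aE; congr (_ - _).
  have -> : 1 + s * P / S = (S + s * P) / S by field; rewrite gt_eqF.
  rewrite /S; field; rewrite -/S !gt_eqF//.
Qed.

(** Expresses that a Gaussian input of variance P has exactly the reference law as output law: the
    densities, averaged over the input, give the constant 1. *)
Lemma idens1_mixture y :
  (\int[normalR 0 (Num.sqrt P)]_x (expR (idens1 x y))%:E = 1)%E.
Proof.
rewrite -expR0; apply: (@normalR_exp 0 P (- (2 * N)^-1) (y / N)
   (capacity - y ^+ 2 / (2 * N) + y ^+ 2 / (2 * S))) => //.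
- have -> : 1 - 2 * - (2 * N)^-1 * P = 1 + P / N by field; rewrite gt_eqF.
  by rewrite addr_gt0// divr_gt0.
- by move=> x; rewrite idens1E; field; rewrite !gt_eqF.
- have -> : 1 - 2 * - (2 * N)^-1 * P = 1 + P / N by field; rewrite gt_eqF.
  rewrite -/capacity; have -> : 1 + P / N = S / N by rewrite /S; field; rewrite gt_eqF.
  by rewrite /S; field; rewrite -/S !gt_eqF.
Qed.

(** The moment of [idens1_mgf] at [- s] is averaged in turn over a Gaussian input. The two
    logarithms telescope to that of [1 - s ^+ 2 * P / S], so the correction to [- s * capacity] is
    of second order in s. *)
Lemma idens1_neg_mgf s : 0 < s -> s < 1 ->
  (\int[normalR 0 (Num.sqrt P)]_x (expR (- s * capacity
      + - s * (1 + - s) * x ^+ 2 / (2 * (S + - s * P)) - 2^-1 * ln (1 + - s * P / S)))%:E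
   = (expR (- s * capacity - 2^-1 * ln (1 - s ^+ 2 * P / S)))%:E)%E.
Proof.
move=> s0 s1.
have h1 : 0 < (1 - s) * P by rewrite mulr_gt0// subr_gt0.
have h2 : 0 < s * ((1 - s) * P) by rewrite mulr_gt0.
have sP : 0 < S + - s * P.
  have -> : S + - s * P = N + (1 - s) * P by rewrite /S; ring.
  by rewrite addr_gt0.
have s2P : 0 < S - s ^+ 2 * P.
  have -> : S - s ^+ 2 * P = N + (1 - s) * P + s * ((1 - s) * P) by rewrite /S; ring.
  by rewrite !addr_gt0.
pose a := - s * (1 - s) / (2 * (S + - s * P)).
have aE : 1 - 2 * a * P = (S - s ^+ 2 * P) / (S + - s * P).
  by rewrite /a /S; field; rewrite -/S gt_eqF.
apply: (@normalR_exp 0 P a 0 (- s * capacity - 2^-1 * ln (1 + - s * P / S))) => //.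
- by rewrite aE divr_gt0.
- by move=> x; rewrite /a subr0; field; rewrite -/S gt_eqF// gt_eqF.
- rewrite aE.
  have -> : 1 + - s * P / S = (S + - s * P) / S by field; rewrite gt_eqF.
  have -> : 1 - s ^+ 2 * P / S = (S - s ^+ 2 * P) / S by field; rewrite gt_eqF.
  rewrite !lnM ?posrE ?invr_gt0// !lnV ?posrE//.
  by rewrite expr0n/= !mul0r addr0; ring.
Qed.

Lemma normal_sqr_mgf t : t * P < 1 ->
  (\int[normalR 0 (Num.sqrt P)]_x (expR (t / 2 * x ^+ 2))%:E =
   (expR (- 2^-1 * ln (1 - t * P)))%:E)%E.
Proof.
move=> tP; have e : 1 - 2 * (t / 2) * P = 1 - t * P by lra.
apply: (@normalR_exp 0 P (t / 2) 0 0) => //.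
- by rewrite e subr_gt0.
- by move=> x; rewrite subr0; ring.
- by rewrite e expr0n/= !mul0r add0r; ring.
Qed.

(** The second moment of a likelihood ratio of two shifted Gaussians, that is, one plus their
    chi-square divergence. *)
Lemma llr_chi2 x x' :
  (\int[normalR x (Num.sqrt N)]_y (expR (2 * llr (Num.sqrt N) (Num.sqrt N) x' x y))%:E =
   (expR ((x - x') ^+ 2 / N))%:E)%E.
Proof.
apply: (@normalR_exp x N 0 (2 * (x' - x) / N) (- (x' - x) ^+ 2 / N)) => //.
- by rewrite mulr0 mul0r subr0.
- by move=> y; rewrite /llr sqr_sqrtr ?ltW//; field; rewrite gt_eqF.
- by rewrite mulr0 mul0r subr0 ln1; field; rewrite gt_eqF.
Qed.

End gauss_mgf.

(** * The channel and its information density *)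

Lemma exp_markov d (T : measurableType d) (R : realType) (mu : {measure set T -> \bar R})
    (B : set T) (g : T -> R) (t : R) :
  measurable B -> measurable_fun setT g -> (forall y, B y -> t <= g y) ->
  (mu B <= (expR (- t))%:E * \int[mu]_y (expR (g y))%:E)%E.
Proof.
move=> mB mg Bg.
have me : measurable_fun setT (fun y => (expR (g y))%:E).
  by apply/measurable_EFinP; exact: measurableT_comp.
rewrite -[X in mu X]setIT -integral_indic// -ge0_integralZl_EFin ?expR_ge0//.
apply: ge0_le_integral => //.
- by apply/measurable_EFinP; exact: measurable_indic.
- exact: emeasurable_funM.
- move=> y _; rewrite -EFinM -expRD lee_fin indicE.
  have [/set_mem/Bg tg|_] := boolP (y \in B); last exact: expR_ge0.
  by rewrite -[X in X <= _]expR0 ler_expR addrC subr_ge0.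
Qed.

Section measurable_level.
Context d (T : measurableType d) (R : realType) (f : T -> R) (t : R).
Hypothesis mf : measurable_fun setT f.

Lemma measurable_gt_level : measurable [set y | t < f y].
Proof.
have -> : [set y | t < f y] = setT `&` f @^-1` `]t, +oo[.
  by rewrite setTI; apply/seteqP; split => y/=; rewrite in_itv/= andbT.
exact: mf.
Qed.

Lemma measurable_le_level : measurable [set y | f y <= t].
Proof.
have -> : [set y | f y <= t] = ~` [set y | t < f y].
  by apply/seteqP; split => y/=; rewrite leNgt => /negP.
by apply: measurableC; exact: measurable_gt_level.
Qed.

End measurable_level.

Section channel.
Context {R : realType}.
Variables (P N : R).
Hypotheses (P0 : 0 < P) (N0 : 0 < N).
Let S := P + N.
Let S0 : 0 < S. Proof. by rewrite addr_gt0. Qed.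
Notation C := (capacity P N).

Definition tzero n : n.-tuple R := nseq_tuple n 0.
Definition awgn n (x : n.-tuple R) : probability (n.-tuple R) R := gausst (Num.sqrt N) x.
Definition gin n : probability (n.-tuple R) R := gausst (Num.sqrt P) (tzero n).
Definition gout n : probability (n.-tuple R) R := gausst (Num.sqrt (P + N)) (tzero n).

Definition idens n (x y : n.-tuple R) : R := \sum_(i < n) idens1 P N (tnth x i) (tnth y i).

Lemma measurable_idens n (x : n.-tuple R) : measurable_fun setT (idens x).
Proof.
apply: (@measurable_tuple_sum _ _ (fun i => idens1 P N (tnth x i))) => i.
exact: measurable_llr.
Qed.

Lemma measurable_idens2 n :
  measurable_fun setT (fun u : n.-tuple R * n.-tuple R => idens u.1 u.2).
Proof.
apply: (@measurable_tuple_sum2 _ _ (idens1 P N)).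
have -> : (fun u : R * R => idens1 P N u.1 u.2) =
    (fun u => C - (u.2 - u.1) ^+ 2 / (2 * N) + u.2 ^+ 2 / (2 * S)).
  by apply/funext => u; rewrite idens1E.
apply: measurable_funD; first apply: measurable_funB => //.
  apply: measurable_funM => //; apply: measurable_funX.
  exact: measurable_funB.
by apply: measurable_funM => //; exact: measurable_funX.
Qed.

Local Open Scope ereal_scope.

Lemma awgn_density n (x : n.-tuple R) (f : n.-tuple R -> \bar R) :
  measurable_fun setT f -> (forall y, 0 <= f y) ->
  \int[awgn x]_y f y = \int[gout n]_y (f y * (expR (idens x y))%:E).
Proof.
move=> mf f0.
have sN0 : (0 < Num.sqrt N)%R by rewrite sqrtr_gt0.
have sS0 : (0 < Num.sqrt S)%R by rewrite sqrtr_gt0.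
apply: (etrans (integral_gausst_llr x (tzero n) sN0 sS0 mf f0)).
apply: eq_integral => y _; congr (_ * (expR _)%:E).
by apply: eq_bigr => i _; rewrite tnth_nseq.
Qed.

(** All channel laws have densities with respect to the single law [gout], jointly measurable in
    both arguments, so measurability in the input is that of a Tonelli partial integral. *)
Lemma measurable_awgn_integral n (F : n.-tuple R * n.-tuple R -> \bar R) :
  measurable_fun setT F -> (forall u, 0 <= F u) ->
  measurable_fun setT (fun x => \int[awgn x]_y F (x, y)).
Proof.
move=> mF F0.
have mG : measurable_fun setT (fun u => F u * (expR (idens u.1 u.2))%:E).
  apply: emeasurable_funM => //; apply/measurable_EFinP.
  by apply: measurableT_comp => //; exact: measurable_idens2.
have := @measurable_fun_fubini_tonelli_F _ _ _ _ _ (gout n) _ mG.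
rewrite (_ : fubini_F _ _ = fun x => \int[awgn x]_y F (x, y)).
  by apply => u; apply: mule_ge0 => //; rewrite lee_fin expR_ge0.
apply/funext => x; rewrite awgn_density//.
by apply: (measurableT_comp mF).
Qed.

Lemma measurable_awgn n (B : set (n.-tuple R)) : measurable B ->
  measurable_fun setT (fun x : n.-tuple R => awgn x B).
Proof.
move=> mB.
rewrite (_ : (fun x => _) = fun x => \int[awgn x]_y (\1_B y)%:E).
  apply: (@measurable_awgn_integral n (fun u => (\1_B u.2)%:E)) => //.
  apply/measurable_EFinP; apply: (measurableT_comp (measurable_indic mB)) => //.
by apply/funext => x; rewrite integral_indic// setIT.
Qed.

Lemma awgn_densityB n (x : n.-tuple R) (B : set (n.-tuple R)) : measurable B ->
  awgn x B = \int[gout n]_(y in B) (expR (idens x y))%:E.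
Proof.
move=> mB; rewrite -[in LHS](setIT B) -integral_indic// awgn_density//; last first.
  by apply/measurable_EFinP; exact: measurable_indic.
rewrite [RHS]integral_mkcond/=; apply: eq_integral => y _.
by rewrite patchE indicE; case: ifP; rewrite ?mul1e ?mul0e.
Qed.

Let measurable_eidens n (x : n.-tuple R) D : measurable_fun D (fun y => (expR (idens x y))%:E).
Proof.
apply: measurable_funTS; apply/measurable_EFinP.
by apply: measurableT_comp => //; exact: measurable_idens.
Qed.

Lemma awgn_le_gout n (x : n.-tuple R) B t : measurable B ->
  (forall y, B y -> (idens x y <= t)%R) -> awgn x B <= (expR t)%:E * gout n B.
Proof.
move=> mB Bt; rewrite awgn_densityB// -integral_cst//.
apply: ge0_le_integral => //.
- exact: measurable_eidens.
- by move=> y By; rewrite lee_fin ler_expR Bt.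
Qed.

Lemma gout_le_awgn n (x : n.-tuple R) B t : measurable B ->
  (forall y, B y -> (t <= idens x y)%R) -> gout n B <= (expR (- t))%:E * awgn x B.
Proof.
move=> mB Bt; rewrite awgn_densityB// -ge0_integralZl_EFin ?expR_ge0//; last first.
  exact: measurable_eidens.
rewrite -[leLHS]mul1e -integral_cst//.
apply: ge0_le_integral => //.
  by apply: emeasurable_funM => //; exact: measurable_eidens.
move=> y By; rewrite -EFinM -expRD lee_fin -[X in (X <= _)%R]expR0 ler_expR.
by rewrite addrC subr_ge0 Bt.
Qed.

Lemma Xn_sum n (x : n.-tuple R) : Xn P n x -> (\sum_(i < n) (tnth x i) ^+ 2 <= n%:R * P)%R.
Proof.
rewrite /Xn/=; case: n x => [|n] x; first by rewrite !big_ord0 mul0r.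
by rewrite mulrC ler_pdivrMr ?ltr0n// mulrC.
Qed.

(** Chernoff with parameter g itself. The moment increases with the energy of x, which is therefore
    replaced by n P; the terms of first order in g then cancel, and a remainder of at most n g^2 / 2
    stands against a gain of n g^2. *)
Lemma idens_upper_tail n (x : n.-tuple R) g : Xn P n x -> (0 < g)%R ->
  awgn x [set y | (n%:R * (C + g) < idens x y)%R] <= (expR (- (n%:R * g ^+ 2 / 2)))%:E.
Proof.
move=> /Xn_sum xP g0.
have mi := measurable_idens x.
have mA : measurable [set y | (n%:R * (C + g) < idens x y)%R].
  exact: measurable_gt_level.
apply: (le_trans (@exp_markov _ _ _ (awgn x) _ (fun y => g * idens x y)%R
  (g * (n%:R * (C + g)))%R mA _ _)).
- exact: measurable_funM.
- by move=> y/= /ltW; rewrite ler_pM2l.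
pose h (i : 'I_n) := (g * C + g * (1 + g) * (tnth x i) ^+ 2 / (2 * (S + g * P))
      - 2^-1 * ln (1 + g * P / S))%R.
have sP : (0 < S + g * P)%R by rewrite addr_gt0// mulr_gt0.
have -> : \int[awgn x]_y (expR (g * idens x y))%:E = (expR (\sum_i h i))%:E.
  apply: etrans (@integral_gausst_exp _ (Num.sqrt N) _ x
      (fun i y => g * idens1 P N (tnth x i) y)%R h _ _).
  - by apply: eq_integral => y _; rewrite mulr_sumr.
  - by move=> i; apply: measurable_funM => //; exact: measurable_llr.
  - by move=> i; rewrite idens1_mgf.
rewrite -EFinM -expRD lee_fin ler_expR.
rewrite /h sumrB big_split/= !sumr_const card_ord -!mulr_suml -mulr_sumr.
have k0 : (0 < 1 + g * P / S)%R by rewrite addr_gt0// divr_gt0// mulr_gt0.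
have := ln_ge_1subV k0.
have -> : (1 - (1 + g * P / S)^-1 = g * P / (S + g * P))%R by field; rewrite !gt_eqF.
set L := ln _ => lnL.
set Q := (\sum_i _)%R in xP *.
have c0 : (0 <= g * (1 + g) / (2 * (S + g * P)))%R.
  by rewrite ltW// divr_gt0 ?mulr_gt0// addr_gt0.
have h1 := ler_wpM2l c0 xP.
have h2 : (g * (1 + g) / (2 * (S + g * P)) * P - 2^-1 * (g * P / (S + g * P)) <= g ^+ 2 / 2)%R.
  have -> : (g * (1 + g) / (2 * (S + g * P)) * P - 2^-1 * (g * P / (S + g * P)) =
     g ^+ 2 / 2 * (P / (S + g * P)))%R by field; rewrite gt_eqF.
  rewrite ler_piMr ?divr_ge0 ?sqr_ge0// ler_pdivrMr// mul1r.
  by rewrite /S -addrA lerDl ltW// addr_gt0// mulr_gt0.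
have n0 : (0 <= n%:R :> R)%R by [].
have h3 := ler_wpM2l n0 h2.
have h4 := ler_wpM2l n0 lnL.
rewrite -[((g * C) *+ n)%R]mulr_natl -[((2^-1 * L) *+ n)%R]mulr_natl.
have -> : (g * (1 + g) * Q / (2 * (S + g * P)) = g * (1 + g) / (2 * (S + g * P)) * Q)%R by ring.
lra.
Qed.

End channel.

Section channel2.
Context {R : realType}.
Variables (P N : R).
Hypotheses (P0 : 0 < P) (N0 : 0 < N).
Let S := P + N.
Let S0 : 0 < S. Proof. by rewrite addr_gt0. Qed.
Notation C := (capacity P N).
Notation idens := (idens P N).
Notation awgn := (awgn N).

Let measurable_expidens2 n :
  measurable_fun setT (fun u : n.-tuple R * n.-tuple R => (expR (idens u.1 u.2))%:E).
Proof.
by apply/measurable_EFinP; apply: measurableT_comp => //; exact: measurable_idens2.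
Qed.

Local Open Scope ereal_scope.

Lemma idens_mixture n (y : n.-tuple R) : \int[gin P n]_x (expR (idens x y))%:E = 1.
Proof.
rewrite -[RHS](_ : (expR (\sum_(i < n) 0))%:E = 1); last by rewrite big1_eq expR0.
apply: (@integral_gausst_exp _ (Num.sqrt P) _ (tzero n)
    (fun i x => idens1 P N x (tnth y i)) (fun=> 0%R)).
- move=> i; have -> : (idens1 P N)^~ (tnth y i) = fun x =>
    (C - (tnth y i - x) ^+ 2 / (2 * N) + tnth y i ^+ 2 / (2 * S))%R.
    by apply/funext => x; rewrite idens1E.
  apply: measurable_funD => //; apply: measurable_funB => //.
  by apply: measurable_funM => //; apply: measurable_funX; exact: measurable_funB.
- by move=> i; rewrite tnth_nseq idens1_mixture// expR0.
Qed.

Lemma awgn_mixture n (D : set (n.-tuple R)) : measurable D ->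
  \int[gin P n]_x awgn x D = gout P N n D.
Proof.
move=> mD.
have mI : measurable_fun setT (fun y => (\1_D y)%:E : \bar R).
  by apply/measurable_EFinP; exact: measurable_indic.
have mI2 : measurable_fun setT (fun u : n.-tuple R * n.-tuple R => (\1_D u.2)%:E : \bar R).
  by apply: (measurableT_comp mI).
transitivity (\int[gin P n]_x \int[gout P N n]_y ((\1_D y)%:E * (expR (idens x y))%:E)).
  apply: eq_integral => x _; rewrite -(awgn_density P0 N0)//.
  by rewrite integral_indic// setIT.
rewrite (fubini_tonelli (fun u => (\1_D u.2)%:E * (expR (idens u.1 u.2))%:E))/=; last 2 first.
- by apply: emeasurable_funM; [exact: mI2|exact: measurable_expidens2].
- by move=> u; rewrite -EFinM lee_fin mulr_ge0// expR_ge0.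
transitivity (\int[gout P N n]_y (\1_D y)%:E); last by rewrite integral_indic// setIT.
apply: eq_integral => y _.
rewrite ge0_integralZl_EFin//.
- by rewrite idens_mixture mule1.
- exact: (measurableT_comp (@measurable_expidens2 n) (pair2_measurable y)).
Qed.

Lemma measurable_awgn_idens_le n t :
  measurable_fun setT (fun x : n.-tuple R => awgn x [set y | (idens x y <= t)%R]).
Proof.
pose A := [set u : n.-tuple R * n.-tuple R | (idens u.1 u.2 <= t)%R].
have mA : measurable A by apply: measurable_le_level; exact: measurable_idens2.
rewrite (_ : (fun x => _) = fun x => \int[awgn x]_y (\1_A (x, y))%:E).
  apply: (@measurable_awgn_integral _ P N P0 N0 n (fun u => (\1_A u)%:E)) => //.
  by apply/measurable_EFinP; exact: measurable_indic.
apply/funext => x.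
have mAx : measurable [set y | (idens x y <= t)%R].
  by apply: measurable_le_level; exact: measurable_idens.
transitivity (\int[awgn x]_y (\1_[set y | (idens x y <= t)%R] y)%:E).
  by rewrite integral_indic// setIT.
apply: eq_integral => y _; rewrite !indicE.
suff -> : (y \in [set y | (idens x y <= t)%R]) = ((x, y) \in A) by [].
by apply/idP/idP => /set_mem h'; exact/mem_set.
Qed.

(** Chernoff at [- s] for each x separately, then the Gaussian average of the resulting moment,
    coordinate by coordinate, from [idens1_neg_mgf]. *)
Lemma idens_lower_tail n g : (0 < g)%R -> (g <= 1)%R ->
  \int[gin P n]_x awgn x [set y | (idens x y <= n%:R * (C - g))%R]
    <= (expR (- (n%:R * g ^+ 2 / 4)))%:E.
Proof.
(* The exponent will be at most n (s^2 - s g), which s = g / 2 minimizes. The bound g <= 1 keeps s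
   at most 1/2, hence u at most 1/4, where ln (1 - u) >= - 2 u. *)
move=> g0 g1; set s := (g / 2)%R; set t := (n%:R * (C - g))%R.
have s0 : (0 < s)%R by rewrite divr_gt0.
have s12 : (s <= 1 / 2)%R by rewrite /s; lra.
have s1 : (s < 1)%R by lra.
have sP : (0 < S + - s * P)%R.
  have -> : (S + - s * P = N + (1 - s) * P)%R by rewrite /S; ring.
  by rewrite addr_gt0// mulr_gt0// subr_gt0.
pose h x := (- s * C + - s * (1 + - s) * x ^+ 2 / (2 * (S + - s * P))
     - 2^-1 * ln (1 + - s * P / S))%R.
have mh : measurable_fun setT h.
  apply: measurable_funB => //; apply: measurable_funD => //.
  by apply: measurable_funM => //; apply: measurable_funM => //; exact: measurable_funX.
have mH : measurable_fun setT (fun x : n.-tuple R => (expR (\sum_(i < n) h (tnth x i)))%:E).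
  apply/measurable_EFinP; apply: measurableT_comp => //.
  exact: (@measurable_tuple_sum _ _ (fun i => h)).
apply: (@le_trans _ _ (\int[gin P n]_x
    ((expR (s * t))%:E * (expR (\sum_(i < n) h (tnth x i)))%:E))).
  apply: ge0_le_integral => //.
  - exact: measurable_awgn_idens_le.
  - exact: emeasurable_funM.
  - move=> x _.
    have mAx : measurable [set y | (idens x y <= t)%R].
      by apply: measurable_le_level; exact: measurable_idens.
    apply: (le_trans (@exp_markov _ _ _ (awgn x) _ (fun y => - s * idens x y)%R
      (- s * t)%R mAx _ _)).
    + by apply: measurable_funM => //; exact: measurable_idens.
    + by move=> y/= yt; rewrite !mulNr lerN2 ler_pM2l.
    rewrite mulNr opprK lee_wpmul2l ?lee_fin ?expR_ge0// le_eqVlt; apply/orP; left; apply/eqP.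
    apply: etrans (@integral_gausst_exp _ (Num.sqrt N) _ x
      (fun i y => - s * idens1 P N (tnth x i) y)%R (fun i => h (tnth x i)) _ _).
    + by apply: eq_integral => y _; rewrite mulr_sumr.
    + by move=> i; apply: measurable_funM => //; exact: measurable_llr.
    + by move=> i; rewrite idens1_mgf.
rewrite ge0_integralZl_EFin ?expR_ge0//.
pose k := (- s * C - 2^-1 * ln (1 - s ^+ 2 * P / S))%R.
have -> : \int[gin P n]_x (expR (\sum_(i < n) h (tnth x i)))%:E = (expR (\sum_(i < n) k))%:E.
  apply: (@integral_gausst_exp _ (Num.sqrt P) _ (tzero n) (fun i => h) (fun=> k)) => //.
  by move=> i; rewrite tnth_nseq idens1_neg_mgf.
rewrite -EFinM -expRD lee_fin ler_expR sumr_const card_ord -[(k *+ n)%R]mulr_natl.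
pose u := (s ^+ 2 * P / S)%R.
have u0 : (0 < u)%R by rewrite divr_gt0// mulr_gt0// exprn_gt0.
have us : (u <= s ^+ 2)%R.
  by rewrite ler_pdivrMr// ler_wpM2l ?sqr_ge0// /S lerDl ltW.
have s2 : (s ^+ 2 <= 1 / 4)%R by rewrite expr2; nra.
have u1 : (0 < 1 - u)%R by lra.
have lnu : (- 2 * u <= ln (1 - u))%R.
  apply: le_trans (ln_ge_1subV u1); rewrite -(ler_pM2r u1) mulrBl mul1r mulVf ?gt_eqF//.
  nra.
have kle : (k <= - s * C + s ^+ 2)%R by rewrite /k -/u; lra.
have n0 : (0 <= n%:R :> R)%R by [].
apply: le_trans (lerD (lexx _) (ler_wpM2l n0 kle)) _.
rewrite /t /s le_eqVlt; apply/orP; left; apply/eqP; by field.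
Qed.

Lemma gin_power_tail P' : (0 < P')%R -> (P' < P)%R -> exists2 k : R, (0 < k)%R &
  forall n, gin P' n (~` Xn P n) <= (expR (- (n%:R * k)))%:E.
Proof.
move=> P'0 P'P.
(* Half of the optimal value 1/P' - 1/P. At the optimum itself the crude bound ln a >= 1 - 1/a used
   below would leave the exponent zero. *)
pose t := ((P - P') / (2 * P * P'))%R.
have d0 : (0 < P - P')%R by rewrite subr_gt0.
have t0 : (0 < t)%R by rewrite divr_gt0// !mulr_gt0.
have tE : (1 - t * P' = (P + P') / (2 * P))%R.
  by rewrite /t; field; rewrite !gt_eqF.
have tP1 : (0 < 1 - t * P')%R by rewrite tE divr_gt0 ?addr_gt0 ?mulr_gt0.
exists (t / 2 * (P * (P - P') / (P + P')))%R.
  apply: mulr_gt0; first exact: divr_gt0.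
  by apply: divr_gt0; [exact: mulr_gt0|exact: addr_gt0].
move=> n.
pose A := [set x : n.-tuple R | (n%:R * P < \sum_(i < n) tnth x i ^+ 2)%R].
have mq : measurable_fun setT (fun x : n.-tuple R => \sum_(i < n) tnth x i ^+ 2)%R.
  by apply: (@measurable_tuple_sum _ _ (fun i x => x ^+ 2)%R) => i; exact: measurable_funX.
have mA : measurable A by exact: measurable_gt_level.
have XA : ~` Xn P n `<=` A.
  move=> x; rewrite /A /Xn/= => /negP; rewrite -ltNge; case: n x {A mq mA} => [|n] x.
    by rewrite !big_ord0 mulr0 ltNge ltW.
  by rewrite -(ltr_pM2l (_ : 0 < n.+1%:R)%R) ?ltr0n// mulrA divff ?mul1r// pnatr_eq0.
have mX : measurable (~` Xn P n).
  rewrite (_ : ~` Xn P n = [set x | P < n%:R^-1 * \sum_(i < n) tnth x i ^+ 2]%R).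
    by apply: measurable_gt_level; exact: measurable_funM.
  by apply/seteqP; split => x; rewrite /Xn/= ltNge => /negP.
apply: (@le_trans _ _ (gin P' n A)); first by rewrite le_measure ?inE.
apply: (le_trans (@exp_markov _ _ _ (gin P' n) _ (fun x => t / 2 * \sum_(i < n) tnth x i ^+ 2)%R
   (t / 2 * (n%:R * P))%R mA _ _)).
- exact: measurable_funM.
- by move=> x/= /ltW; rewrite ler_pM2l// divr_gt0.
pose k := (- 2^-1 * ln (1 - t * P'))%R.
have -> : \int[gin P' n]_x (expR (t / 2 * \sum_(i < n) tnth x i ^+ 2))%:E =
    (expR (\sum_(i < n) k))%:E.
  apply: etrans (@integral_gausst_exp _ (Num.sqrt P') _ (tzero n)
     (fun i x => t / 2 * x ^+ 2)%R (fun=> k) _ _).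
  - by apply: eq_integral => x _; rewrite mulr_sumr.
  - by move=> i; apply: measurable_funM => //; exact: measurable_funX.
  - by move=> i; rewrite tnth_nseq normal_sqr_mgf//; rewrite -subr_gt0.
rewrite -EFinM -expRD lee_fin ler_expR sumr_const card_ord -[(k *+ n)%R]mulr_natl.
have := ln_ge_1subV tP1; set L := ln _ => hL.
have hL2 : (- (t * P / (P + P') * P') * 2 <= L)%R.
  apply: le_trans hL; rewrite tE le_eqVlt; apply/orP; left; apply/eqP.
  by rewrite /t; field; rewrite !gt_eqF// addr_gt0.
have kle : (k <= t * P / (P + P') * P')%R by rewrite /k -/L; lra.
have n0 : (0 <= n%:R :> R)%R by [].
apply: le_trans (lerD (lexx _) (ler_wpM2l n0 kle)) _.
rewrite le_eqVlt; apply/orP; left; apply/eqP; field.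
by rewrite gt_eqF// addr_gt0.
Qed.

(* The hypothesis bounds the chi-square divergence of awgn x' from awgn x by e ^ 2. *)
Lemma awgn_continuity n (x x' : n.-tuple R) (B : set (n.-tuple R)) (e : R) :
  measurable B -> (0 < e)%R ->
  (expR (\sum_(i < n) (tnth x i - tnth x' i) ^+ 2 / N) <= 1 + e ^+ 2)%R ->
  awgn x' B <= awgn x B + e%:E.
Proof.
move=> mB e0 hx.
have sN0 : (0 < Num.sqrt N)%R by rewrite sqrtr_gt0.
pose l (y : n.-tuple R) :=
  (\sum_(i < n) llr (Num.sqrt N) (Num.sqrt N) (tnth x' i) (tnth x i) (tnth y i))%R.
have ml : measurable_fun setT l.
  apply: (@measurable_tuple_sum _ _
    (fun i => llr (Num.sqrt N) (Num.sqrt N) (tnth x' i) (tnth x i))).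
  by move=> i; exact: measurable_llr.
pose u y := expR (l y).
have u0 y : (0 <= u y)%R by exact: expR_ge0.
have mu : measurable_fun setT u by exact: measurableT_comp.
have chg (f : n.-tuple R -> R) : measurable_fun setT f -> (forall y, 0 <= f y)%R ->
    \int[awgn x']_y (f y)%:E = \int[awgn x]_y (f y * u y)%:E.
  move=> mf f0; have mf' : measurable_fun setT (EFin \o f) by exact/measurable_EFinP.
  have f0' y : 0 <= (EFin \o f) y by rewrite lee_fin.
  exact: (integral_gausst_llr x' x sN0 sN0 mf' f0').
have mI : measurable_fun setT (\1_B : n.-tuple R -> R) by exact: measurable_indic.
have I0 y : (0 <= \1_B y :> R)%R by [].
have int1 : \int[awgn x]_y (u y)%:E = 1.
  transitivity (\int[awgn x']_y (cst 1%R y)%:E).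
    by rewrite chg//; apply: eq_integral => y _; rewrite mul1r.
  apply: etrans (integral_cst (awgn x') measurableT 1%E) _.
  by rewrite mul1e; exact: probability_setT.
have intB : \int[awgn x]_y (\1_B y * u y)%:E = awgn x' B.
  by rewrite -chg// integral_indic// setIT.
have int2 : \int[awgn x]_y (u y ^+ 2)%:E <= (1 + e ^+ 2)%:E.
  apply: le_trans (_ : _ <= (expR (\sum_(i < n) (tnth x i - tnth x' i) ^+ 2 / N))%:E) _.
    rewrite le_eqVlt; apply/orP; left; apply/eqP.
    apply: etrans (@integral_gausst_exp _ (Num.sqrt N) _ x
      (fun i y => 2 * llr (Num.sqrt N) (Num.sqrt N) (tnth x' i) (tnth x i) y)%R
      (fun i => (tnth x i - tnth x' i) ^+ 2 / N)%R _ _).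
    - apply: eq_integral => y _; rewrite -mulr_sumr -/(l y) /u expr2 -expRD.
      by congr (expR _)%:E; ring.
    - by move=> i; apply: measurable_funM => //; exact: measurable_llr.
    - by move=> i; exact: llr_chi2.
  by rewrite lee_fin.
(* With p the indicator of B and u the likelihood ratio, this is p (u - 1) <= ((u - 1)^2 + e^2) / (2
   e), rearranged so that only nonnegative functions are integrated. *)
have key : \int[awgn x]_y ((\1_B y * u y)%:E + (e^-1)%:E * (u y)%:E) <=
   \int[awgn x]_y ((\1_B y)%:E + ((2 * e)^-1%:E * (u y ^+ 2)%:E + ((2 * e)^-1 + e / 2)%:E)).
  have mBu : measurable_fun setT (fun y => (\1_B y * u y)%R) by exact: measurable_funM.
  have mu2 : measurable_fun setT (fun y => (u y ^+ 2)%R) by exact: measurable_funX.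
  apply: ge0_le_integral => //.
  - by move=> y _; rewrite -EFinM -EFinD lee_fin addr_ge0 ?mulr_ge0 ?invr_ge0 ?(ltW e0).
  - apply: emeasurable_funD; first exact/measurable_EFinP.
    by apply: emeasurable_funM => //; exact/measurable_EFinP.
  - apply: emeasurable_funD; first exact/measurable_EFinP.
    by apply: emeasurable_funD => //; apply: emeasurable_funM => //; exact/measurable_EFinP.
  - move=> y _; rewrite -!EFinM -!EFinD lee_fin.
    have sq1 : (0 <= ((u y - 1) - e) ^+ 2)%R by exact: sqr_ge0.
    have sq2 : (0 <= (u y - 1) ^+ 2 + e ^+ 2)%R by rewrite addr_ge0 ?sqr_ge0.
    rewrite -(ler_pM2r (_ : 0 < 2 * e)%R) ?mulr_gt0//.
    have -> : ((\1_B y + ((2 * e)^-1 * u y ^+ 2 + ((2 * e)^-1 + e / 2))) * (2 * e) =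
       \1_B y * 2 * e + u y ^+ 2 + 1 + e ^+ 2)%R by field; rewrite gt_eqF.
    have -> : ((\1_B y * u y + e^-1 * u y) * (2 * e) = \1_B y * u y * 2 * e + 2 * u y)%R.
      by field; rewrite gt_eqF.
    rewrite indicE; case: (_ \in _) => /=.
      rewrite mulr1n !mul1r; nra.
    rewrite mulr0n !mul0r; nra.
move: key.
have mBu : measurable_fun setT (fun y => (\1_B y * u y)%:E).
  by apply/measurable_EFinP; exact: measurable_funM.
have mu' : measurable_fun setT (fun y => (u y)%:E) by exact/measurable_EFinP.
have mu2 : measurable_fun setT (fun y => (u y ^+ 2)%:E).
  by apply/measurable_EFinP; exact: measurable_funX.
have ei0 : (0 <= e^-1)%R by rewrite invr_ge0 ltW.
have e2i0 : (0 <= (2 * e)^-1)%R by rewrite invr_ge0 mulr_ge0 ?(ltW e0).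
have c0 : (0 <= (2 * e)^-1 + e / 2)%R by rewrite addr_ge0 ?divr_ge0 ?(ltW e0).
rewrite ge0_integralD//; last 3 first.
- by move=> y _; rewrite lee_fin mulr_ge0.
- by move=> y _; rewrite -EFinM lee_fin mulr_ge0.
- exact: emeasurable_funM.
rewrite ge0_integralZl_EFin//; last by move=> y _; rewrite lee_fin.
rewrite int1 mule1 intB.
rewrite ge0_integralD//; last 3 first.
- by apply/measurable_EFinP.
- by move=> y _; rewrite -EFinM -EFinD lee_fin addr_ge0 ?mulr_ge0 ?sqr_ge0.
- by apply: emeasurable_funD => //; exact: emeasurable_funM.
rewrite ge0_integralD//; last 2 first.
- by move=> y _; rewrite -EFinM lee_fin mulr_ge0 ?sqr_ge0.
- exact: emeasurable_funM.
rewrite ge0_integralZl_EFin//; last by move=> y _; rewrite lee_fin sqr_ge0.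
have -> : \int[awgn x]_y ((2 * e)^-1 + e / 2)%:E = ((2 * e)^-1 + e / 2)%:E.
  apply: etrans (integral_cst (awgn x) measurableT _) _.
  rewrite -[RHS]mule1; congr (_ * _); exact: probability_setT.
have -> : \int[awgn x]_y (\1_B y)%:E = awgn x B by rewrite integral_indic// setIT.
have [r' ->] : exists r, awgn x' B = r%:E.
  by exists (fine (awgn x' B)); rewrite fineK// fin_num_measure.
have [r ->] : exists r, awgn x B = r%:E.
  by exists (fine (awgn x B)); rewrite fineK// fin_num_measure.
move=> key.
have h2 : (2 * e)^-1%:E * \int[awgn x]_y (u y ^+ 2)%:E <= (2 * e)^-1%:E * (1 + e ^+ 2)%:E.
  by apply: lee_wpmul2l => //; rewrite lee_fin.
have := le_trans key (leeD2l _ (leeD2r _ h2)).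
rewrite -EFinM -!EFinD !lee_fin.
have -> : ((2 * e)^-1 * (1 + e ^+ 2) + ((2 * e)^-1 + e / 2) = e^-1 + e)%R by field; rewrite gt_eqF.
lra.
Qed.

End channel2.

(** * Transmission codes *)

Section pr.
Context d (T : measurableType d) (R : realType) (mu : probability T R).
Implicit Types A B : set T.

Definition pr A : R := fine (mu A).

Lemma prE A : measurable A -> mu A = (pr A)%:E.
Proof. by move=> mA; rewrite fineK// fin_num_measure. Qed.

Lemma pr_ge0 A : 0 <= pr A. Proof. exact: fine_ge0. Qed.

Lemma pr_le1 A : measurable A -> pr A <= 1.
Proof. by move=> mA; rewrite -lee_fin -prE// probability_le1. Qed.

Lemma prC A : measurable A -> pr (~` A) = 1 - pr A.
Proof.
move=> mA; apply: EFin_inj; rewrite -prE; last exact: measurableC.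
by rewrite probability_setC// prE.
Qed.

Lemma le_pr A B : measurable A -> measurable B -> A `<=` B -> pr A <= pr B.
Proof. by move=> mA mB AB; rewrite -lee_fin -!prE// le_measure ?inE. Qed.

Lemma pr_setID A B : measurable A -> measurable B -> pr A = pr (A `\` B) + pr (A `&` B).
Proof.
move=> mA mB; apply: EFin_inj; rewrite EFinD -!prE//.
- exact: measureDI.
- exact: measurableI.
- exact: measurableD.
Qed.

Lemma pr_bigsetU n (F : 'I_n -> set T) : (forall i, measurable (F i)) -> trivIset setT F ->
  pr (\big[setU/set0]_(i < n) F i) = \sum_(i < n) pr (F i).
Proof.
move=> mF tF; apply: EFin_inj; rewrite -prE; last exact: bigsetU_measurable.
rewrite measure_bigsetU_ord//.
by rewrite -sumEFin; apply: eq_bigr => i _; exact: prE.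
Qed.

End pr.

Section codes.
Context {R : realType}.
Variables (P N : R).
Hypotheses (P0 : 0 < P) (N0 : 0 < N).
Notation C := (capacity P N).
Notation awgn := (awgn N).

Lemma Wn_pr n (x : n.-tuple R) B : measurable B -> Wn N x B = (pr (awgn x) B)%:E.
Proof. by move=> mB; rewrite WnE// prE. Qed.

Lemma measurable_idens_gt n (x : n.-tuple R) t : measurable [set y | t < idens P N x y].
Proof. by apply: measurable_gt_level; exact: measurable_idens. Qed.

Lemma measurable_idens_le n (x : n.-tuple R) t : measurable [set y | idens P N x y <= t].
Proof. by apply: measurable_le_level; exact: measurable_idens. Qed.

Lemma tcode_err_pr n M (enc : 'I_M -> n.-tuple R) dec :
  is_tcode P enc dec ->
  tcode_err N enc dec =
  (M%:R^-1 * \sum_(i < M) (1 - pr (awgn (enc i)) (dec @^-1` [set i])))%:E.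
Proof.
move=> [_ mD]; rewrite /tcode_err EFinM -sumEFin; congr (_ * _)%E.
apply: eq_bigr => i _; rewrite Wn_pr ?prC//; exact: measurableC.
Qed.

(** Outside the upper-tail event a decoding set has channel probability at most
    [expR (n%:R * (C + g))] times its [gout] measure. Decoding sets are disjoint, so these measures
    sum to at most 1: all M messages share this one factor. *)
Lemma tcode_converse n M (enc : 'I_M -> n.-tuple R) dec g :
  is_tcode P enc dec -> (0 < M)%N -> 0 < g ->
  ((1 - expR (- (n%:R * g ^+ 2 / 2)) - expR (n%:R * (C + g)) / M%:R)%:E
    <= tcode_err N enc dec)%E.
Proof.
move=> code M0 g0; have [encX mD] := code.
rewrite (tcode_err_pr code) lee_fin.
set a := expR (- _); set T := expR _.
pose D i := dec @^-1` [set i].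
have sumq : \sum_(i < M) pr (gout P N n) (D i) <= 1.
  rewrite -pr_bigsetU//; first by apply: pr_le1; apply: bigsetU_measurable => i _; exact: mD.
  by move=> i j _ _ [y [/= <- <-]].
have pD i : pr (awgn (enc i)) (D i) <= a + T * pr (gout P N n) (D i).
  pose A := [set y | n%:R * (C + g) < idens P N (enc i) y].
  have mA : measurable A by exact: measurable_idens_gt.
  have mDi : measurable (D i) by exact: mD.
  rewrite (pr_setID _ mDi mA) addrC; apply: lerD.
    apply: (@le_trans _ _ (pr (awgn (enc i)) A)).
      by apply: le_pr => //; exact: measurableI.
    by rewrite -lee_fin -prE//; exact: idens_upper_tail.
  apply: (@le_trans _ _ (T * pr (gout P N n) (D i `\` A))).
    rewrite -lee_fin EFinM -!prE//; try exact: measurableD.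
    apply: awgn_le_gout => //; first exact: measurableD.
    by move=> y [_ /negP]; rewrite -leNgt.
  rewrite ler_wpM2l ?expR_ge0//.
  by apply: le_pr; [exact: measurableD|exact: mD|exact: subDsetl].
have M0' : 0 < M%:R :> R by rewrite ltr0n.
rewrite [leRHS]mulrC ler_pdivlMr// !mulrBl divfK ?gt_eqF// mul1r.
apply: (@le_trans _ _ (\sum_(i < M) (1 - (a + T * pr (gout P N n) (D i))))); last first.
  by apply: ler_sum => i _; rewrite lerB.
rewrite sumrB big_split/= !sumr_const card_ord -mulr_sumr -[a *+ M]mulr_natr.
rewrite opprD addrA lerB// ler_piMr ?expR_ge0//.
Qed.

(* Greedy choice: if no codeword could be added, the decoding sets found so far would
   have channel probability at least e - awgn x (~` B x) for every x in Xn P, and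
   averaging over the Gaussian input gin P' would make their gout P' measure too large. *)
Lemma feinstein n (P' t e b k : R) (M : nat) : 0 < P' ->
  0 <= e ->
  (\int[gin P' n]_x awgn x [set y | (idens P' N x y <= t)%R] <= b%:E)%E ->
  (gin P' n (~` Xn P n) <= k%:E)%E ->
  M%:R * expR (- t) + b + k * e < e ->
  exists (x : nat -> n.-tuple R) (D : nat -> set (n.-tuple R)),
   [/\ forall i, (i < M)%N -> Xn P n (x i),
       forall i, measurable (D i),
       forall i, (i < M)%N -> pr (awgn (x i)) (~` D i) <= e &
       trivIset `I_M D].
Proof.
move=> P'0 e0 hb hk hM.
(* The induction needs each decoding set inside the region where the information density of its
   codeword exceeds t: this caps its [gout] measure at [expR (- t)]. *)
suff [x [D [xX mD eD tD _]]] : exists (x : nat -> n.-tuple R) (D : nat -> set (n.-tuple R)),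
   [/\ forall i, (i < M)%N -> Xn P n (x i),
       forall i, measurable (D i),
       forall i, (i < M)%N -> pr (awgn (x i)) (~` D i) <= e,
       trivIset `I_M D &
       forall i, (i < M)%N -> D i `<=` [set y | t < idens P' N (x i) y]].
  by exists x, D.
have mX : measurable (Xn P n).
  apply: measurable_le_level; apply: measurable_funM => //.
  by apply: (@measurable_tuple_sum _ _ (fun i x => x ^+ 2)) => i; exact: measurable_funX.
elim: M hM => [|M IH] hM.
  by exists (fun=> tzero n), (fun=> set0); split => //; rewrite II0; exact: trivIset_set0.
have {}/IH [x [D [xX mD eD tD Dt]]] : M%:R * expR (- t) + b + k * e < e.
  apply: le_lt_trans hM; rewrite !lerD2r ler_wpM2r ?expR_ge0// ler_nat//.
pose U := \big[setU/set0]_(i < M) D i.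
have mU : measurable U by apply: bigsetU_measurable => i _; exact: mD.
have gU : pr (gout P' N n) U <= M%:R * expR (- t).
  rewrite /U pr_bigsetU//; last first.
    move=> i j _ _ Dij; apply: val_inj; apply: (tD i j) => //=; exact: ltn_ord.
  apply: (@le_trans _ _ (\sum_(i < M) expR (- t))); last by rewrite sumr_const card_ord mulr_natl.
  apply: ler_sum => i _; rewrite -lee_fin -prE//.
  apply: (le_trans (@gout_le_awgn _ P' N P'0 N0 n (x i) _ t (mD i) _)).
    by move=> y /(Dt i (ltn_ord i))/= /ltW.
  rewrite prE// -EFinM lee_fin ler_piMr ?expR_ge0//; exact: pr_le1.
pose B (x : n.-tuple R) := [set y | t < idens P' N x y].
have mB z : measurable (B z) by apply: measurable_gt_level; exact: measurable_idens.
have [z [zX zB]] : exists z, Xn P n z /\ 1 - e <= pr (awgn z) (B z `\` U).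
  apply: contrapT => /forallNP noz.
  have zle z : Xn P n z -> e <= pr (awgn z) U + pr (awgn z) (~` B z).
    move=> zX; have /not_andP[//|/negP] := noz z; rewrite -ltNge => zB.
    have h1 : pr (awgn z) (B z) <= pr (awgn z) (B z `\` U) + pr (awgn z) U.
      rewrite {1}(pr_setID (awgn z) (mB z) mU) lerD2l.
      by apply: le_pr => //; exact: measurableI.
    have := prC (awgn z) (mB z); lra.
  have BE z : ~` B z = [set y | idens P' N z y <= t].
    by apply/seteqP; split => y/=; rewrite leNgt => /negP.
  have mle : measurable_fun setT (fun z => awgn z (~` B z)).
    under eq_fun do rewrite BE.
    exact: measurable_awgn_idens_le.
  have : (e%:E * gin P' n (Xn P n) <= \int[gin P' n]_z (awgn z U + awgn z (~` B z)))%E.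
    rewrite -[X in gin _ _ X]setIT -integral_indic// -ge0_integralZl_EFin//; last first.
      by apply/measurable_EFinP; exact: measurable_indic.
    apply: ge0_le_integral => //.
    - by move=> y _; rewrite -EFinM lee_fin mulr_ge0.
    - by apply: emeasurable_funM => //; apply/measurable_EFinP; exact: measurable_indic.
    - by apply: emeasurable_funD => //; exact: measurable_awgn.
    move=> y _; rewrite !prE//; last exact: measurableC.
    rewrite -EFinM -EFinD lee_fin indicE.
    have [/set_mem/zle|_] := boolP (y \in Xn P n); first by rewrite mulr1.
    by rewrite mulr0 addr_ge0// pr_ge0.
  rewrite ge0_integralD//; last exact: measurable_awgn.
  rewrite awgn_mixture//.
  under [X in (_ + X)%E]eq_integral do rewrite BE.
  move=> /le_trans/(_ (leeD2l _ hb)).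
  move: hk; rewrite !prE//; last exact: measurableC.
  rewrite lee_fin prC// => hk; rewrite -EFinM -EFinD lee_fin => he.
  have he2 : (1 - pr (gin P' n) (Xn P n)) * e <= k * e by rewrite ler_wpM2r.
  have : M%:R * expR (- t) <= M.+1%:R * expR (- t) :> R.
    by rewrite ler_wpM2r ?expR_ge0// ler_nat.
  lra.
exists (fun i => if i == M then z else x i), (fun i => if i == M then B z `\` U else D i).
have mBU : measurable (B z `\` U) by exact: measurableD.
split.
- move=> i; case: eqP => // /eqP iM; rewrite ltnS leq_eqVlt (negbTE iM)/=; exact: xX.
- by move=> i; case: eqP.
- move=> i; case: eqP => [_ _|/eqP iM]; last first.
    by rewrite ltnS leq_eqVlt (negbTE iM)/=; exact: eD.
  by rewrite prC//; lra.
- have ltM i : (i < M.+1)%N -> i <> M -> (i < M)%N.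
    by rewrite ltnS leq_eqVlt => /orP[/eqP|].
  move=> i j /= iM jM; case: eqP => [->|ni]; case: eqP => [->//|nj].
  + move=> [y [[_ Uy] Dy]]; exfalso; apply: Uy.
    rewrite /U -(bigcup_mkord M D); exists j => //; exact: ltM.
  + move=> [y [Dy [_ Uy]]]; exfalso; apply: Uy.
    rewrite /U -(bigcup_mkord M D); exists i => //; exact: ltM.
  + by apply: tD; exact: ltM.
- move=> i; case: eqP => [_ _|/eqP iM]; first exact: subDsetl.
  by rewrite ltnS leq_eqVlt (negbTE iM)/=; exact: Dt.
Qed.

End codes.

(** * Soft covering *)

Lemma ge0_le_integralT d (T : measurableType d) (R : realType) (mu : {measure set T -> \bar R})
    (f g : T -> \bar R) :
  measurable_fun setT f -> measurable_fun setT g ->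
  (forall x, 0 <= f x)%E -> (forall x, f x <= g x)%E ->
  (\int[mu]_x f x <= \int[mu]_x g x)%E.
Proof. by move=> mf mg f0 fg; apply: ge0_le_integral. Qed.

Lemma integral_prob_cst d (T : measurableType d) (R : realType) (mu : probability T R) (r : R) :
  (\int[mu]__ r%:E = r%:E)%E.
Proof.
apply: etrans (integral_cst mu measurableT r%:E) _.
rewrite -[RHS]mule1; congr (_ * _)%E; exact: probability_setT.
Qed.

Lemma ge0_integral_lin d (T : measurableType d) (R : realType) (mu : {measure set T -> \bar R})
    (f g : T -> R) (a : R) :
  measurable_fun setT f -> measurable_fun setT g ->
  (forall x, 0 <= f x) -> (forall x, 0 <= g x) -> 0 <= a ->
  (\int[mu]_x ((f x)%:E + a%:E * (g x)%:E) =
   \int[mu]_x (f x)%:E + a%:E * \int[mu]_x (g x)%:E)%E.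
Proof.
move=> mf mg f0 g0 a0.
have mf' : measurable_fun setT (fun x => (f x)%:E) by exact/measurable_EFinP.
have mg' : measurable_fun setT (fun x => (g x)%:E) by exact/measurable_EFinP.
have f0' x : setT x -> (0 <= (f x)%:E)%E by rewrite lee_fin.
have g0' x : setT x -> (0 <= (g x)%:E)%E by rewrite lee_fin.
rewrite -(ge0_integralZl_EFin mu measurableT g0' mg' a0).
have ag0 x : setT x -> (0 <= a%:E * (g x)%:E)%E by rewrite -EFinM lee_fin mulr_ge0.
have mag : measurable_fun setT (fun x => (a%:E * (g x)%:E)%E) by exact: emeasurable_funM.
exact: (ge0_integralD mu measurableT f0' mf' ag0 mag).
Qed.

Section maurey.
Context d (T : measurableType d) d' (T' : measurableType d') (R : realType).
Variables (Q : probability T R) (G : probability T' R) (X : set T).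
Variables (v : T -> T' -> R) (c : R).
Hypotheses (mX : measurable X) (QX : Q X = 1%E) (c0 : 0 < c).
Hypothesis mv : measurable_fun setT (fun u : T * T' => v u.1 u.2).
Hypothesis v0 : forall x y, 0 <= v x y.
Hypothesis vc : forall x y, v x y <= c.
Hypothesis v1 : forall x, (\int[G]_y (v x y)%:E <= 1)%E.
Local Open Scope ereal_scope.

Definition mean (y : T') : R := fine (\int[Q]_x (v x y)%:E).

Let mv1 y : measurable_fun setT (v ^~ y).
Proof. exact: (measurableT_comp mv (pair2_measurable y)). Qed.

Let mv2 x : measurable_fun setT (v x).
Proof. exact: (measurableT_comp mv (pair1_measurable x)). Qed.

Lemma meanE y : \int[Q]_x (v x y)%:E = (mean y)%:E.
Proof.
rewrite fineK// ge0_fin_numE; last by apply: integral_ge0 => x _; rewrite lee_fin.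
apply: (@le_lt_trans _ _ (\int[Q]_x c%:E)).
  apply: ge0_le_integralT => [|//|x|x]; rewrite ?lee_fin//; exact/measurable_EFinP.
by rewrite integral_prob_cst ltry.
Qed.

Lemma mean_ge0 y : (0 <= mean y)%R.
Proof. by apply: fine_ge0; apply: integral_ge0 => x _; rewrite lee_fin. Qed.

Lemma measurable_mean : measurable_fun setT mean.
Proof.
apply: measurableT_comp => //.
apply: (measurable_fun_fubini_tonelli_G (fun u => (v u.1 u.2)%:E)) => [|u].
- exact/measurable_EFinP.
- by rewrite lee_fin.
Qed.

Lemma integral_mean (g : T' -> \bar R) : measurable_fun setT g -> (forall y, 0 <= g y) ->
  \int[G]_y (g y * (mean y)%:E) = \int[Q]_x \int[G]_y (g y * (v x y)%:E).
Proof.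
move=> mg g0.
rewrite (fubini_tonelli (fun u => g u.2 * (v u.1 u.2)%:E))/=; last 2 first.
- apply: emeasurable_funM; first exact: (measurableT_comp mg).
  exact/measurable_EFinP.
- by move=> u; rewrite mule_ge0// lee_fin.
apply: eq_integral => y _; rewrite -meanE ge0_integralZl//.
- exact/measurable_EFinP.
- by move=> x _; rewrite lee_fin.
Qed.

(* Averaging over [x ~ Q] cancels the cross term, so some [x] does not increase the
   squared L2 norm by more than the second moment of [v x]; the factor 2 leaves
   room for choosing [x] inside the full-measure set [X]. *)
Lemma maurey_step (s : T' -> R) (K : R) : measurable_fun setT s ->
  \int[G]_y (s y ^+ 2)%:E <= K%:E ->
  exists x, X x /\ \int[G]_y ((s y + (v x y - mean y)) ^+ 2)%:E <= (K + 2 * c)%:E.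
Proof.
move=> ms sK; apply: contrapT => /forallNP nox.
pose F (u : T * T') := ((s u.2 + (v u.1 u.2 - mean u.2)) ^+ 2)%R.
have mF : measurable_fun setT F.
  apply: measurable_funX; apply: measurable_funD; first exact: (measurableT_comp ms).
  by apply: measurable_funB => //; exact: (measurableT_comp measurable_mean).
have F0 u : (0 <= F u)%R by exact: sqr_ge0.
have mEF : measurable_fun setT (EFin \o F) by exact/measurable_EFinP.
have Egt x : X x -> (K + 2 * c)%:E <= \int[G]_y (F (x, y))%:E.
  by move=> Xx; have /not_andP[//|/negP] := nox x; rewrite -ltNge => /ltW.
have lo : (K + 2 * c)%:E <= \int[Q]_x \int[G]_y (F (x, y))%:E.
  have K0 : (0 <= K)%R.
    by rewrite -lee_fin; apply: le_trans sK; apply: integral_ge0 => y _; rewrite lee_fin sqr_ge0.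
  rewrite -[leLHS]mule1 -QX -[X in Q X]setIT -integral_indic// -ge0_integralZl_EFin//; last 2 first.
  - by apply/measurable_EFinP; exact: measurable_indic.
  - by rewrite addr_ge0// mulr_ge0// ltW.
  apply: ge0_le_integralT.
  - by apply: emeasurable_funM => //; apply/measurable_EFinP; exact: measurable_indic.
  - exact: (measurable_fun_fubini_tonelli_F (EFin \o F)).
  - by move=> x; rewrite -EFinM lee_fin mulr_ge0// addr_ge0// mulr_ge0// ltW.
  move=> x; rewrite indicE; have [/set_mem/Egt|_] := boolP (x \in X); first by rewrite mule1.
  by rewrite mule0; apply: integral_ge0 => y _; rewrite lee_fin.
have inner y : \int[Q]_x (F (x, y))%:E <= (s y ^+ 2)%:E + c%:E * (mean y)%:E.
  (* The average of (r + v)^2 is at most r^2 + 2 r mean + c mean, and r^2 + 2 r mean = s^2 - mean^2.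
     As r has no fixed sign, it is split into [rp - rn] and the part with [rn] is moved to the left,
     which leaves nonnegative integrands. *)
  pose r := (s y - mean y)%R.
  pose rp := Num.max r 0%R; pose rn := Num.max (- r)%R 0%R.
  have rp0 : (0 <= rp)%R by rewrite le_max lexx orbT.
  have rn0 : (0 <= rn)%R by rewrite le_max lexx orbT.
  have rE : (r = rp - rn)%R.
    by rewrite /rp /rn; case: (leP r 0%R) => r0; case: (leP (- r)%R 0%R) => r1; lra.
  have mvy : measurable_fun setT (fun x => (v x y)%:E) by exact/measurable_EFinP.
  have mFy : measurable_fun setT (fun x => (F (x, y))%:E).
    exact: (measurableT_comp mEF (pair2_measurable y)).
  have hle : \int[Q]_x ((F (x, y))%:E + (2 * rn)%:E * (v x y)%:E) <=
      \int[Q]_x ((r ^+ 2)%:E + (2 * rp + c)%:E * (v x y)%:E).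
    apply: ge0_le_integralT.
    - by apply: emeasurable_funD => //; exact: emeasurable_funM.
    - by apply: emeasurable_funD => //; exact: emeasurable_funM.
    - by move=> x; rewrite -EFinM -EFinD lee_fin addr_ge0// !mulr_ge0.
    move=> x; rewrite -!EFinM -!EFinD lee_fin /F/=.
    have -> : (s y + (v x y - mean y) = r + v x y)%R by rewrite /r; ring.
    have : (v x y ^+ 2 <= c * v x y)%R by rewrite expr2 ler_wpM2r.
    rewrite sqrrD [in X in (_ -> (_ + X + _ + _ <= _)%R)]rE -mulr_natl; nra.
  have mFy' : measurable_fun setT (fun x => F (x, y)) by exact/measurable_EFinP.
  move: hle; rewrite ge0_integral_lin ?mulr_ge0//.
  have a0 : (0 <= 2 * rp + c)%R by rewrite addr_ge0 ?(ltW c0)// mulr_ge0.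
  rewrite (@ge0_integral_lin _ _ _ Q (fun=> r ^+ 2)%R (v ^~ y) _ (measurable_cst _) (@mv1 y)
    (fun=> sqr_ge0 r) (fun x => v0 x y) a0).
  rewrite integral_prob_cst meanE -!EFinM -!EFinD.
  rewrite -leeBrDr// -EFinB => /le_trans; apply; rewrite lee_fin.
  have -> : (2 * rp = 2 * r + 2 * rn)%R by rewrite rE; ring.
  have := sqr_ge0 (mean y); rewrite /r; nra.
have hi : \int[Q]_x \int[G]_y (F (x, y))%:E <= (K + c)%:E.
  rewrite (fubini_tonelli (EFin \o F))//.
  apply: (@le_trans _ _ (\int[G]_y ((s y ^+ 2)%:E + c%:E * (mean y)%:E))).
    apply: ge0_le_integralT => //.
    - exact: (measurable_fun_fubini_tonelli_G (EFin \o F)).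
    - apply: emeasurable_funD; first by apply/measurable_EFinP; exact: measurable_funX.
      by apply: emeasurable_funM => //; apply/measurable_EFinP; exact: measurable_mean.
    - by move=> y; apply: integral_ge0 => x _; rewrite lee_fin.
  rewrite ge0_integral_lin ?(ltW c0)//; last 4 first.
  - exact: measurable_funX.
  - exact: measurable_mean.
  - by move=> y; exact: sqr_ge0.
  - exact: mean_ge0.
  rewrite EFinD leeD// -[leRHS]mule1 lee_wpmul2l ?lee_fin ?(ltW c0)//.
  under eq_integral do rewrite -[(mean _)%:E]mul1e.
  rewrite (integral_mean (g := fun=> 1))//.
  rewrite -[leRHS](integral_prob_cst Q); apply: ge0_le_integralT => //.
  - apply: (measurable_fun_fubini_tonelli_F (fun u => 1 * (v u.1 u.2)%:E)) => //.
      by apply: emeasurable_funM => //; exact/measurable_EFinP.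
    by move=> u; rewrite mul1e lee_fin.
  - by move=> x; apply: integral_ge0 => y _; rewrite mul1e lee_fin.
  - by move=> x; under eq_integral do rewrite mul1e.
by have := le_trans lo hi; rewrite lee_fin lerD2l leNgt ltr_pMl// ltr1n.
Qed.

(** For the empirical mean, division by M^2 leaves a squared error 2 c / M: a number of points
    somewhat larger than the bound c on the densities suffices. *)
Lemma maurey M : exists x : nat -> T, (forall j, (j < M)%N -> X (x j)) /\
  \int[G]_y ((\sum_(j < M) (v (x j) y - mean y)) ^+ 2)%:E <= (M%:R * (2 * c))%:E.
Proof.
elim: M => [|M [x [xX xK]]].
  exists (fun=> point); split => //.
  by rewrite mul0r; under eq_integral do rewrite big_ord0 expr0n/=; rewrite integral0.
pose s y := (\sum_(j < M) (v (x j) y - mean y))%R.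
have ms : measurable_fun setT s.
  apply: measurable_sum => j; apply: measurable_funB => //; exact: measurable_mean.
have [z [zX zK]] := maurey_step ms xK.
exists (fun j => if j == M then z else x j); split.
  move=> j; case: eqP => // /eqP jM; rewrite ltnS leq_eqVlt (negbTE jM)/=; exact: xX.
rewrite -natr1 mulrDl mul1r; apply: le_trans zK.
rewrite le_eqVlt; apply/orP; left; apply/eqP; apply: eq_integral => y _.
rewrite big_ord_recr/= eqxx; congr ((_ + _) ^+ 2)%:E%R.
by apply: eq_bigr => j _; rewrite ltn_eqF.
Qed.

End maurey.

(* AM-GM replaces the Cauchy-Schwarz inequality: |D| <= (D^2 + a^2) / (2 a). *)
Lemma le_integral_L2 d (T : measurableType d) (R : realType) (mu : probability T R)
    (p q D : T -> R) (a : R) :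
  measurable_fun setT p -> measurable_fun setT q -> measurable_fun setT D ->
  (forall y, 0 <= p y) -> (forall y, 0 <= q y) -> (forall y, p y <= q y + `|D y|) ->
  0 < a -> (\int[mu]_y (D y ^+ 2)%:E <= (a ^+ 2)%:E)%E ->
  (\int[mu]_y (p y)%:E <= \int[mu]_y (q y)%:E + a%:E)%E.
Proof.
move=> mp mq mD p0 q0 pq a0 Da.
have mD2 : measurable_fun setT (fun y => D y ^+ 2) by exact: measurable_funX.
have D0 y : 0 <= D y ^+ 2 by exact: sqr_ge0.
have mDa : measurable_fun setT (fun y => D y ^+ 2 + a ^+ 2) by exact: measurable_funD.
have Da0 y : 0 <= D y ^+ 2 + a ^+ 2 by rewrite addr_ge0 ?sqr_ge0.
have k0 : 0 <= (2 * a)^-1 by rewrite invr_ge0 mulr_ge0 ?(ltW a0).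
apply: (@le_trans _ _ (\int[mu]_y ((q y)%:E + (2 * a)^-1%:E * (D y ^+ 2 + a ^+ 2)%:E))%E).
  apply: ge0_le_integralT.
  - exact/measurable_EFinP.
  - by apply: emeasurable_funD; [|apply: emeasurable_funM => //]; exact/measurable_EFinP.
  - by move=> y; rewrite lee_fin.
  move=> y; rewrite -EFinM -EFinD lee_fin; apply: (le_trans (pq y)); rewrite lerD2l.
  rewrite mulrC ler_pdivlMr ?mulr_gt0//.
  have := sqr_ge0 (`|D y| - a); rewrite -(real_normK (num_real (D y))); nra.
rewrite ge0_integral_lin//; apply: leeD2l.
have -> : (\int[mu]_y (D y ^+ 2 + a ^+ 2)%:E = \int[mu]_y (D y ^+ 2)%:E + (a ^+ 2)%:E)%E.
  transitivity (\int[mu]_y ((D y ^+ 2)%:E + (a ^+ 2)%:E * (cst 1 y)%:E))%E.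
    by apply: eq_integral => y _; rewrite mule1.
  rewrite (@ge0_integral_lin _ _ _ mu (fun y => D y ^+ 2) (cst 1)) ?sqr_ge0//.
  by rewrite integral_prob_cst mule1.
have h := @lee_wpmul2l _ ((2 * a)^-1)%:E k0 _ _ (leeD2r (a ^+ 2)%:E Da).
apply: (le_trans h); rewrite -EFinD -EFinM lee_fin le_eqVlt; apply/orP; left; apply/eqP.
by field; rewrite gt_eqF.
Qed.

Section soft_covering.
Context {R : realType}.
Variables (P N : R).
Hypotheses (P0 : 0 < P) (N0 : 0 < N).
Notation C := (capacity P N).
Notation awgn := (awgn N).

Lemma measurable_Xn n : measurable (Xn P n).
Proof.
apply: measurable_le_level; apply: measurable_funM => //.
by apply: (@measurable_tuple_sum _ _ (fun i x => x ^+ 2)) => i; exact: measurable_funX.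
Qed.

Lemma QW_awgn n (Q : probability (n.-tuple R) R) B : measurable B ->
  QW N Q B = (\int[Q]_x awgn x B)%E.
Proof. by move=> mB; apply: eq_integral => x _; rewrite WnE. Qed.

Lemma unif_out_pr n M (phi : 'I_M -> n.-tuple R) B : measurable B ->
  unif_out N phi B = (M%:R^-1 * \sum_(j < M) pr (awgn (phi j)) B)%:E.
Proof.
move=> mB; rewrite /unif_out EFinM -sumEFin; congr (_ * _)%E.
by apply: eq_bigr => j _; rewrite Wn_pr.
Qed.

Lemma QW_fin n (Q : probability (n.-tuple R) R) B : measurable B ->
  QW N Q B = (fine (QW N Q B))%:E.
Proof.
move=> mB; rewrite fineK// ge0_fin_numE; last first.
  by rewrite QW_awgn//; apply: integral_ge0 => x _; exact: measure_ge0.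
apply: (@le_lt_trans _ _ 1%E); last by rewrite ltry.
rewrite QW_awgn// -[leRHS](integral_prob_cst Q); apply: ge0_le_integralT => //.
- exact: measurable_awgn.
- by move=> x; exact: probability_le1.
Qed.

Section truncated_density.
Variables (n : nat) (t : R).
Implicit Types x y : n.-tuple R.

Definition tdens x y : R := if idens P N x y <= t then expR (idens P N x y) else 0.

Lemma tdens_ge0 x y : 0 <= tdens x y.
Proof. by rewrite /tdens; case: ifP. Qed.

Lemma tdens_le x y : tdens x y <= expR t.
Proof. by rewrite /tdens; case: ifP => [|_]; rewrite ?ler_expR ?expR_ge0. Qed.

Lemma measurable_tdens2 :
  measurable_fun setT (fun u : n.-tuple R * n.-tuple R => tdens u.1 u.2).
Proof.
apply: measurable_fun_ifT => //.
  by apply: measurable_fun_ler => //; exact: measurable_idens2.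
by apply: measurableT_comp => //; exact: measurable_idens2.
Qed.

Lemma integral_tdens x B : measurable B ->
  (\int[gout P N n]_y (\1_B y * tdens x y)%:E =
   (pr (awgn x) (B `&` [set y | idens P N x y <= t]))%:E)%E.
Proof.
move=> mB; have mBi : measurable (B `&` [set y | idens P N x y <= t]).
  by apply: measurableI => //; exact: measurable_idens_le.
rewrite -prE// -[in RHS](setIT (B `&` _)) -integral_indic//.
rewrite (awgn_density P0 N0)//; last by apply/measurable_EFinP; exact: measurable_indic.
apply: eq_integral => y _; rewrite -EFinM; congr (_%:E).
rewrite /tdens !indicE in_setI; case: (y \in B); rewrite /= ?mul0r// mul1r.
have [ti|ti] := boolP (idens P N x y <= t).
  by rewrite mem_set// mul1r.
by rewrite memNset ?mul0r//; apply/negP.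
Qed.

Lemma integral_tdens_le1 x : (\int[gout P N n]_y (tdens x y)%:E <= 1)%E.
Proof.
rewrite (_ : integral _ _ _ = \int[gout P N n]_y (\1_setT y * tdens x y)%:E)%E; last first.
  by apply: eq_integral => y _; rewrite indicT mul1r.
rewrite integral_tdens// setTI lee_fin; apply: pr_le1; exact: measurable_idens_le.
Qed.

End truncated_density.

(* Replacing the density of awgn x with respect to gout by tdens costs a mass of at most
   exp(- n g^2 / 2), uniformly over Xn P; the truncated densities are bounded by
   exp(n (C + g)), hence maurey applies to them in L2(gout). *)
Lemma soft_covering n (Q : probability (n.-tuple R) R) g M :
  Q (Xn P n) = 1%E -> 0 < g -> (0 < M)%N ->
  exists phi : 'I_M -> n.-tuple R, (forall i, Xn P n (phi i)) /\
  (vdist (QW N Q) (unif_out N phi) <=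
    (2 * (expR (- (n%:R * g ^+ 2 / 2)) + Num.sqrt (2 * expR (n%:R * (C + g)) / M%:R)))%:E)%E.
Proof.
move=> QX g0 M0; set a := expR (- _); set t := n%:R * (C + g); set c := expR t.
have c0 : 0 < c by exact: expR_gt0.
pose v := tdens t (n := n).
have mv := @measurable_tdens2 n t.
have [x [xX xK]] := @maurey _ _ _ _ _ Q (gout P N n) (Xn P n) v c (@measurable_Xn n) QX c0
  mv (@tdens_ge0 _ t) (@tdens_le _ t) (@integral_tdens_le1 _ t) M.
exists (fun j : 'I_M => x j); split; first by move=> i; exact: xX.
pose m := mean Q v.
have mm : measurable_fun setT m by exact: (measurable_mean Q mv (@tdens_ge0 n t)).
have m0 y : 0 <= m y by exact: (mean_ge0 Q (@tdens_ge0 n t)).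
have M0' : 0 < M%:R :> R by rewrite ltr0n.
set tau := Num.sqrt _.
have tau0 : 0 < tau by rewrite sqrtr_gt0 divr_gt0 ?mulr_gt0.
rewrite EFinM /vdist; apply: lee_wpmul2l; first by rewrite lee_fin.
apply: ge_ereal_sup => _ [B /= mB <-].
rewrite unif_out_pr// QW_fin// -EFinB abse_EFin lee_fin.
set q := fine _.
have mI : measurable_fun setT (\1_B : n.-tuple R -> R) by exact: measurable_indic.
have I0 y : 0 <= \1_B y :> R by [].
(* [q] and [s] are the output probabilities of B under Q and under the code, [Im] and [u] their
   truncated versions. [Im] and [u] differ by at most tau by [maurey]. Truncation only lowers, by at
   most a: [Im <= q <= Im + a] and [u <= s <= u + a], so a enters once, not twice. *)
pose w z := pr (awgn z) (B `&` [set y | idens P N z y <= t]).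
have mle (z : n.-tuple R) : measurable [set y | idens P N z y <= t] by exact: measurable_idens_le.
have w_le z : w z <= pr (awgn z) B.
  by apply: le_pr => //; apply: measurableI => //; exact: mle.
have le_w z : Xn P n z -> pr (awgn z) B <= w z + a.
  move=> zX; rewrite (pr_setID (awgn z) mB (mle z)) addrC lerD2l.
  apply: (@le_trans _ _ (pr (awgn z) [set y | t < idens P N z y])).
    apply: le_pr; [exact: measurableD|exact: measurable_idens_gt|].
    by move=> y [_ /negP]; rewrite -ltNge.
  rewrite -lee_fin -prE; last exact: measurable_idens_gt.
  exact: idens_upper_tail.
have mw : measurable_fun setT w.
  apply/measurable_EFinP.
  rewrite (_ : EFin \o w = fun z => \int[gout P N n]_y (\1_B y * v z y)%:E)%E; last first.
    by apply/funext => z; rewrite integral_tdens.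
  apply: (measurable_fun_fubini_tonelli_F
    (fun u : n.-tuple R * n.-tuple R => (\1_B u.2 * v u.1 u.2)%:E)) => [|u].
    apply/measurable_EFinP; apply: measurable_funM => //.
    exact: (measurableT_comp mI).
  by rewrite lee_fin mulr_ge0// tdens_ge0.
pose Im := fine (\int[gout P N n]_y (\1_B y * m y)%:E)%E.
have intw : (\int[Q]_z (w z)%:E = \int[gout P N n]_y (\1_B y * m y)%:E)%E.
  under [RHS]eq_integral do rewrite EFinM.
  rewrite (@integral_mean _ _ _ _ _ Q (gout P N n) v c mv (@tdens_ge0 _ t) (@tdens_le _ t)
    (fun y => (\1_B y)%:E))//.
    by apply: eq_integral => z _; under [RHS]eq_integral do rewrite -EFinM; rewrite integral_tdens.
  exact/measurable_EFinP.
have ImE : (\int[gout P N n]_y (\1_B y * m y)%:E = Im%:E)%E.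
  rewrite /Im fineK// -intw ge0_fin_numE; last first.
    by apply: integral_ge0 => z _; rewrite lee_fin pr_ge0.
  apply: (@le_lt_trans _ _ 1%E); last by rewrite ltry.
  rewrite -[leRHS](integral_prob_cst Q); apply: ge0_le_integralT => //.
  - exact/measurable_EFinP.
  - by move=> z; rewrite lee_fin pr_ge0.
  - by move=> z; rewrite lee_fin; apply: pr_le1; exact: measurableI.
have mpr : measurable_fun setT (fun z => (pr (awgn z) B)%:E).
  by under eq_fun do rewrite -prE//; exact: measurable_awgn.
have qE : q%:E = (\int[Q]_z (pr (awgn z) B)%:E)%E.
  by rewrite /q -QW_fin// QW_awgn//; apply: eq_integral => z _; rewrite prE.
have Imq : Im <= q.
  rewrite -lee_fin -ImE qE -intw; apply: ge0_le_integralT => //.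
  - exact/measurable_EFinP.
  - by move=> z; rewrite lee_fin pr_ge0.
have qIm : q <= Im + a.
  rewrite -lee_fin EFinD -ImE qE -intw.
  have a0 : 0 <= a by exact: expR_ge0.
  (* The bound by [w z + a] is known on [Xn P n] only. Off it the indicator supplies the trivial
     bound 1, at no cost since Q gives that set mass 0. *)
  pose f z := w z + \1_(~` Xn P n) z.
  have mXC : measurable_fun setT (\1_(~` Xn P n) : n.-tuple R -> R).
    by apply: measurable_indic; apply: measurableC; exact: measurable_Xn.
  have mf : measurable_fun setT f by exact: measurable_funD.
  have f0 z : 0 <= f z by rewrite addr_ge0 ?pr_ge0.
  apply: (@le_trans _ _ (\int[Q]_z ((f z)%:E + a%:E * (cst 1 z)%:E))%E).
    apply: ge0_le_integralT => //.
    - apply: emeasurable_funD; first exact/measurable_EFinP.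
      by apply: emeasurable_funM => //; exact/measurable_EFinP.
    - by move=> z; rewrite lee_fin pr_ge0.
    move=> z; rewrite -EFinM -EFinD lee_fin mulr1 /f indicE.
    have [zX|zX] := boolP (z \in ~` Xn P n).
      rewrite -addrA -[leLHS]add0r lerD ?pr_ge0//.
      by rewrite (le_trans (pr_le1 _ mB))// lerDl.
    by rewrite addr0 le_w//; apply: contrapT => nzX; move/negP: zX; apply; rewrite inE.
  rewrite (@ge0_integral_lin _ _ _ Q f (cst 1))//.
  rewrite integral_prob_cst mule1 leeD2r//.
  under eq_integral do rewrite EFinD -[X in (_ + X)%E]mul1e.
  rewrite (@ge0_integral_lin _ _ _ Q w)//; last by move=> z; exact: pr_ge0.
  rewrite mul1e integral_indic//; last by apply: measurableC; exact: measurable_Xn.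
  have QXC : Q (~` Xn P n) = 0%E.
    have := probability_setC Q (@measurable_Xn n).
    by rewrite QX subee.
  rewrite setIT [X in (_ + X <= _)%E](_ : _ = 0%E); last exact: QXC.
  by rewrite adde0.
pose u := M%:R^-1 * \sum_(j < M) w (x j).
have sumw : (\int[gout P N n]_y (\1_B y * \sum_(j < M) v (x j) y)%:E =
    (\sum_(j < M) w (x j))%:E)%E.
  rewrite -sumEFin; under eq_integral do rewrite mulr_sumr -sumEFin.
  rewrite ge0_integral_sum//.
  - by apply: eq_bigr => j _; rewrite integral_tdens.
  - move=> j; apply/measurable_EFinP; apply: measurable_funM => //.
    exact: (measurableT_comp mv (pair1_measurable (x j))).
  - by move=> j y _; rewrite lee_fin mulr_ge0 ?tdens_ge0.
have MIm : (\int[gout P N n]_y (\1_B y * (M%:R * m y))%:E = (M%:R * Im)%:E)%E.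
  rewrite EFinM -ImE -ge0_integralZl_EFin//.
  - by apply: eq_integral => y _; rewrite -EFinM mulrCA.
  - by move=> y _; rewrite lee_fin mulr_ge0.
  - by apply/measurable_EFinP; exact: measurable_funM.
pose D y := \sum_(j < M) (v (x j) y - m y).
have DE y : D y = \sum_(j < M) v (x j) y - M%:R * m y.
  by rewrite /D sumrB sumr_const card_ord mulr_natl.
have mvj j : measurable_fun setT (v (x j)).
  exact: (measurableT_comp mv (pair1_measurable (x j))).
have msv : measurable_fun setT (fun y => \sum_(j < M) v (x j) y) by exact: measurable_sum.
have mMm : measurable_fun setT (fun y => M%:R * m y) by exact: measurable_funM.
have mD : measurable_fun setT D.
  rewrite (_ : D = fun y => \sum_(j < M) v (x j) y - M%:R * m y); last exact/funext.
  exact: measurable_funB.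
have sv0 y : 0 <= \sum_(j < M) v (x j) y by apply: sumr_ge0 => j _; exact: tdens_ge0.
have th0 : 0 < M%:R * tau by rewrite mulr_gt0.
have DL2 : (\int[gout P N n]_y (D y ^+ 2)%:E <= ((M%:R * tau) ^+ 2)%:E)%E.
  apply: (le_trans xK); rewrite lee_fin exprMn /tau sqr_sqrtr; last first.
    by rewrite divr_ge0 ?mulr_ge0 ?(ltW c0) ?(ltW M0').
  rewrite le_eqVlt; apply/orP; left; apply/eqP; rewrite -/c; field; exact: lt0r_neq0.
have dD (s s' : R) y : \1_B y * s <= \1_B y * s' + `|s - s'|.
  rewrite indicE; case: (_ \in _); rewrite ?mul1r ?mul0r ?add0r// -lerBlDl; exact: ler_norm.
have up1 : M%:R * Im <= \sum_(j < M) w (x j) + M%:R * tau.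
  rewrite -lee_fin EFinD -sumw -MIm.
  apply: (@le_integral_L2 _ _ _ _ _ _ D) => //; try exact: measurable_funM.
  - by move=> y; rewrite !mulr_ge0.
  - by move=> y; rewrite mulr_ge0.
  - by move=> y; rewrite DE distrC; exact: dD.
have up2 : \sum_(j < M) w (x j) <= M%:R * Im + M%:R * tau.
  rewrite -lee_fin EFinD -sumw -MIm.
  apply: (@le_integral_L2 _ _ _ _ _ _ D) => //; try exact: measurable_funM.
  - by move=> y; rewrite mulr_ge0.
  - by move=> y; rewrite !mulr_ge0.
  - by move=> y; rewrite DE; exact: dD.
have u1 : Im <= u + tau.
  by rewrite -(ler_pM2l M0') mulrDr /u mulrA divff ?mul1r// gt_eqF.
have u2 : u <= Im + tau.
  by rewrite -(ler_pM2l M0') mulrDr /u mulrA divff ?mul1r// gt_eqF.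
set s := M%:R^-1 * _.
have us : u <= s.
  by rewrite /u /s ler_pM2l ?invr_gt0//; apply: ler_sum => j _; exact: w_le.
have su : s <= u + a.
  have -> : u + a = M%:R^-1 * \sum_(j < M) (w (x j) + a).
    rewrite big_split/= sumr_const card_ord mulrDr /u; congr (_ + _).
    by rewrite -[a *+ M]mulr_natl mulrA mulVf ?mul1r// gt_eqF.
  by rewrite /s ler_pM2l ?invr_gt0//; apply: ler_sum => j _; apply: le_w; exact: xX.
by rewrite ler_norml; apply/andP; split; lra.
Qed.

End soft_covering.

(** * Counting quantized resolvability codes *)

Section counting.
Context {R : realType}.
Variables (P N : R).
Hypotheses (P0 : 0 < P) (N0 : 0 < N).
Notation awgn := (awgn N).

(** A grid of step h on [-b, b]. [inord] falls back on a default for indices beyond A, which the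
    size condition of [cell_close] excludes. *)
Definition cell (h b : R) A (z : R) : 'I_A.+1 := inord (Num.trunc ((z + b) / h)).

Lemma cell_close h b A z z' : 0 < h -> (2 * b) / h < A.+1%:R -> `|z| <= b -> `|z'| <= b ->
  cell h b A z = cell h b A z' -> `|z - z'| <= h.
Proof.
move=> h0 hA zb z'b.
have key w : `|w| <= b -> 0 <= (w + b) / h /\ (Num.trunc ((w + b) / h) < A.+1)%N.
  rewrite ler_norml => /andP[w1 w2].
  have w0 : 0 <= (w + b) / h by rewrite divr_ge0 ?(ltW h0)//; lra.
  split => //; rewrite truncn_lt_nat//; apply: le_lt_trans hA.
  by rewrite ler_pM2r ?invr_gt0//; lra.
have [z0 zA] := key _ zb; have [z'0 z'A] := key _ z'b.
move=> /(congr1 (@nat_of_ord _)); rewrite !inordK// => e.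
have /andP[a1 a2] := truncn_itv z0; have /andP[b1 b2] := truncn_itv z'0.
rewrite -e in b1 b2; move: (Num.trunc _) a1 a2 b1 b2 => k.
rewrite -!natr1 ler_pdivlMr// ltr_pdivrMr// ler_pdivlMr// ltr_pdivrMr// => a1 a2 b1 b2.
by rewrite ler_norml; apply/andP; split; nra.
Qed.

(** Rounding by coordinates: two inputs of the power ball with the same cells have channel laws of
    chi-square divergence at most e^2. A polynomial number of cells per coordinate is what the
    double logarithm absorbs. *)
Lemma input_quantization e : 0 < e -> exists2 a : R, 0 < a &
  forall n, (0 < n)%N -> exists A (c : n.-tuple R -> {ffun 'I_n -> 'I_A.+1}),
    A.+1%:R <= a * n%:R ^+ 2 /\
    forall x x', Xn P n x -> Xn P n x' -> c x = c x' ->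
      forall B, measurable B -> pr (awgn x') B <= pr (awgn x) B + e.
Proof.
move=> e0; pose k := Num.sqrt (N * ln (1 + e ^+ 2)).
have l0 : 0 < ln (1 + e ^+ 2) by rewrite ln_gt0// ltrDl exprn_gt0.
have k0 : 0 < k by rewrite sqrtr_gt0 mulr_gt0.
exists (2 * (P + 1) / k + 1) => [|n n0].
  by rewrite addr_gt0// divr_gt0// mulr_gt0// addr_gt0.
have n0' : 0 < n%:R :> R by rewrite ltr0n.
have n1 : 1 <= n%:R :> R by rewrite ler1n.
(* The range b avoids a square root: z^2 <= n P gives |z| <= n P + 1. The step h makes n h^2 / N at
   most ln (1 + e^2), as [awgn_continuity] requires; the number of cells is then of order n^2. *)
pose b := n%:R * P + 1; pose h := k / n%:R.
have h0 : 0 < h by rewrite divr_gt0.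
have bh0 : 0 <= 2 * b / h.
  by rewrite divr_ge0 ?(ltW h0)// mulr_ge0// addr_ge0// mulr_ge0// ltW.
pose A := Num.trunc (2 * b / h).
have /andP[A1 A2] := truncn_itv bh0; rewrite -/A in A1 A2.
exists A, (fun x => [ffun i => cell h b A (tnth x i)]); split.
  rewrite -natr1; apply: (@le_trans _ _ (2 * b / h + 1)); first by rewrite lerD2r.
  have -> : 2 * b / h = 2 / k * (n%:R * b) by rewrite /h; field; rewrite !gt_eqF.
  have -> : 2 * (P + 1) / k = 2 / k * (P + 1) by ring.
  rewrite [leRHS]mulrDl; apply: lerD; last by rewrite mul1r expr_ge1// ltW.
  rewrite -[leRHS]mulrA ler_wpM2l ?divr_ge0 ?(ltW k0)// expr2 [leRHS]mulrCA ler_wpM2l ?(ltW n0')//.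
  by rewrite /b; nra.
move=> x x' xX x'X cE B mB.
have tb (z : n.-tuple R) i : Xn P n z -> `|tnth z i| <= b.
  move=> /Xn_sum zX.
  have : tnth z i ^+ 2 <= n%:R * P.
    apply: le_trans zX; rewrite (bigD1 i)//= lerDl; apply: sumr_ge0 => j _; exact: sqr_ge0.
  rewrite -(real_normK (num_real (tnth z i))) /b.
  have := sqr_ge0 (`|tnth z i| - 1); have := normr_ge0 (tnth z i); nra.
rewrite -lee_fin EFinD -!prE//; apply: awgn_continuity => //.
apply: (@le_trans _ _ (expR (ln (1 + e ^+ 2)))); last first.
  by rewrite lnK// posrE addr_gt0// exprn_gt0.
rewrite ler_expR.
apply: (@le_trans _ _ (\sum_(i < n) h ^+ 2 / N)).
  apply: ler_sum => i _; rewrite ler_pM2r ?invr_gt0//.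
  rewrite -(real_normK (num_real (_ - _))) ler_pXn2r ?nnegrE ?(ltW h0)//.
  apply: (@cell_close h b A) => //; [exact: tb|exact: tb|].
  by move/ffunP/(_ i): cE; rewrite !ffunE.
rewrite sumr_const card_ord -[_ *+ n]mulr_natl /h expr_div_n /k sqr_sqrtr; last first.
  by rewrite ltW// mulr_gt0.
have -> : n%:R * (N * ln (1 + e ^+ 2) / n%:R ^+ 2 / N) = ln (1 + e ^+ 2) / n%:R.
  by field; rewrite !gt_eqF.
by rewrite ler_pdivrMr// ler_peMr// ltW.
Qed.

Lemma vdist_le n (Q : probability (n.-tuple R) R) M (phi : 'I_M -> n.-tuple R) d B :
  (vdist (QW N Q) (unif_out N phi) <= (2 * d)%:E)%E -> measurable B ->
  `|fine (QW N Q B) - M%:R^-1 * \sum_(j < M) pr (awgn (phi j)) B| <= d.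
Proof.
rewrite /vdist EFinM => h mB.
have h' : (ereal_sup [set `|QW N Q B - unif_out N phi B|%E | B in
    [set B | measurable B]] <= d%:E)%E.
  by rewrite -(@lee_pmul2l _ 2%:E)// ?fin_numE//.
rewrite -lee_fin; apply: le_trans h'; apply: ereal_sup_ubound; exists B => //.
by rewrite unif_out_pr// QW_fin.
Qed.

Lemma QW_setC n (Q : probability (n.-tuple R) R) B : measurable B ->
  fine (QW N Q (~` B)) = 1 - fine (QW N Q B).
Proof.
move=> mB; have mC : measurable (~` B) by exact: measurableC.
apply: (@addrI _ (fine (QW N Q B))); rewrite [RHS]addrC subrK.
apply: EFin_inj; rewrite EFinD -!QW_fin// !QW_awgn// -ge0_integralD//; last 2 first.
- exact: measurable_awgn.
- exact: measurable_awgn.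
rewrite -[RHS](integral_prob_cst Q); apply: eq_integral => x _.
by rewrite !prE// -EFinD prC// addrC subrK.
Qed.

(* Two identification messages sharing the size and the quantized points of their
   resolvability codes could not be told apart. *)
Lemma id_counting n K (Q : 'I_K -> probability (n.-tuple R) R) D L A
    (c : n.-tuple R -> {ffun 'I_n -> 'I_A.+1}) (d e m l : R) :
  is_idcode P Q D ->
  (id_mu N Q D <= m%:E)%E -> (id_lambda N Q D <= l%:E)%E ->
  (forall x x', Xn P n x -> Xn P n x' -> c x = c x' ->
      forall B, measurable B -> pr (awgn x') B <= pr (awgn x) B + e) ->
  (forall i, exists M (phi : 'I_M -> n.-tuple R), [/\ (0 < M)%N, (M <= L)%N,
      forall k, Xn P n (phi k) & (vdist (QW N (Q i)) (unif_out N phi) <= (2 * d)%:E)%E]) ->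
  m + l + 2 * d + e < 1 ->
  (K <= L.+1 * ((A.+1 ^ n) ^ L))%N.
Proof.
move=> [_ mD] hmu hla cP hphi hlt.
(* Codes of different sizes are brought into one type, as functions on nat with the filler [tzero n]
   beyond the size. *)
have {}hphi i : exists Mx : nat * (nat -> n.-tuple R), [/\ (0 < Mx.1)%N, (Mx.1 <= L)%N,
    forall k, (k < Mx.1)%N -> Xn P n (Mx.2 k) &
    forall B, measurable B ->
      `|fine (QW N (Q i) B) - Mx.1%:R^-1 * \sum_(k < Mx.1) pr (awgn (Mx.2 k)) B| <= d].
  have [M [phi [M0 ML phiX phid]]] := hphi i.
  exists (M, fun k => if insub k is Some o then phi o else tzero n); split => //=.
    by move=> k kM; rewrite insubT.
  move=> B mB; under eq_bigr do rewrite valK.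
  exact: vdist_le.
have {hphi} [f fP] := choice hphi.
(* The signature of a message: the size of its code, at most L, and the cells of L points, those
   beyond the size being arbitrary. *)
pose F i : 'I_L.+1 * {ffun 'I_L -> {ffun 'I_n -> 'I_A.+1}} :=
  (inord (f i).1, [ffun k : 'I_L => c ((f i).2 k)]).
suff Finj : injective F.
  have := leq_card F Finj.
  by rewrite card_prod !card_ffun !card_ord.
move=> i j [/(congr1 (@nat_of_ord _)) MM /ffunP cc]; apply: contrapT => ij.
have [Mi0 MiL xiX xid] := fP i; have [Mj0 MjL xjX xjd] := fP j.
rewrite !inordK ?ltnS// in MM.
have mDi := mD i.
have hi : fine (QW N (Q i) (~` D i)) <= m.
  rewrite -lee_fin -(QW_fin N0); last exact: measurableC.
  by apply: le_trans hmu; exact: le_bigmax.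
have hj : fine (QW N (Q j) (D i)) <= l.
  rewrite -lee_fin -(QW_fin N0)//; apply: le_trans hla.
  apply: (@bigmax_sup _ _ _ _ i) => //.
  apply: (@le_bigmax_cond _ _ _ _ j (fun j => j != i) (fun j => QW N (Q j) (D i))).
  by apply/eqP => ji; exact: ij.
have di := xid _ mDi; have dj := xjd _ mDi.
have uu : (f i).1%:R^-1 * \sum_(k < (f i).1) pr (awgn ((f i).2 k)) (D i) <=
    (f j).1%:R^-1 * \sum_(k < (f j).1) pr (awgn ((f j).2 k)) (D i) + e.
  rewrite -MM.
  have M0 : 0 < (f i).1%:R :> R by rewrite ltr0n.
  rewrite -(ler_pM2l M0) mulrDr !mulrA divff ?gt_eqF// !mul1r.
  have -> : (f i).1%:R * e = \sum_(k < (f i).1) e by rewrite sumr_const card_ord mulr_natl.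
  rewrite -big_split/=; apply: ler_sum => k _; apply: cP => //.
  - by apply: xjX; rewrite -MM.
  - exact: xiX.
  - have kL : (k < L)%N by apply: leq_trans MiL.
    by have := cc (Ordinal kL); rewrite !ffunE.
(* With U_i, U_j the outputs of the two codes: 1 - m <= Q_i W(D_i) <= U_i(D_i) + d <= U_j(D_i) + e +
   d <= Q_j W(D_i) + e + 2 d <= l + e + 2 d, which is below 1. *)
move: di dj; rewrite !ler_norml => /andP[d1 d2] /andP[d3 d4].
move: hi; rewrite QW_setC// => hi.
suff : 1 < 1 :> R by rewrite ltxx.
lra.
Qed.

End counting.

(** * Rates *)

Section asymptotics.
Context {R : realType}.
Implicit Types (u : nat -> \bar R) (a c e l : R).

Lemma limn_esup_near u (a : \bar R) : (limn_esup u < a)%E -> \forall n \near \oo, (u n <= a)%E.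
Proof.
move=> /ereal_inf_lt[_ [V FV <-] Va].
apply: filterS FV => n Vn; apply: ltW; apply: le_lt_trans Va.
by apply: ereal_sup_ubound; exists n.
Qed.

Lemma limn_esup_le u l :
  (forall e, 0 < e -> \forall n \near \oo, (u n <= (l + e)%:E)%E) -> (limn_esup u <= l%:E)%E.
Proof.
move=> h; apply/lee_addgt0Pr => e e0; rewrite -EFinD.
apply: (@le_trans _ _ (ereal_sup (u @` [set n | (u n <= (l + e)%:E)%E]))).
  by apply: ereal_inf_lbound; exists [set n | (u n <= (l + e)%:E)%E] => //; exact: h.
by apply: ge_ereal_sup => _ [n /= un <-].
Qed.

Lemma limn_einf_near u (a : \bar R) : (a < limn_einf u)%E -> \forall n \near \oo, (a <= u n)%E.
Proof.
rewrite /limn_einf lteNr => /limn_esup_near; apply: filterS => n.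
by rewrite leeN2.
Qed.

Lemma limn_einf_ge u l :
  (\forall n \near \oo, (l%:E <= u n)%E) -> (l%:E <= limn_einf u)%E.
Proof.
move=> h; rewrite /limn_einf leeNr -EFinN; apply: limn_esup_le => e e0.
apply: filterS h => n ln; apply: (@le_trans _ _ (- l)%:E); first by rewrite EFinN leeN2.
by rewrite lee_fin lerDl ltW.
Qed.

Lemma near_natr (x : R) : \forall n \near \oo, x <= n%:R.
Proof.
exists (Num.trunc `|x|).+1 => // n /= hn.
apply: (le_trans (ler_norm x)); apply: ltW.
by apply: (lt_le_trans (truncnS_gt _)); rewrite ler_nat.
Qed.

(** With d = c / (k + 1), exp(n c) is the power of order k + 1 of exp(n d), which exceeds n d. The
    spare factor n then beats the constant. *)
Lemma near_pow_le_exp k a c : 0 < c -> \forall n \near \oo, a * n%:R ^+ k <= expR (n%:R * c).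
Proof.
move=> c0; pose d := c / k.+1%:R.
have d0 : 0 < d by rewrite divr_gt0 ?ltr0n.
have := near_natr (a / d ^+ k.+1); apply: filterS => n.
rewrite ler_pdivrMr ?exprn_gt0// => an.
apply: (@le_trans _ _ ((n%:R * d) ^+ k.+1)).
  by rewrite exprMn [n%:R ^+ k.+1]exprS mulrAC ler_wpM2r ?exprn_ge0.
apply: (@le_trans _ _ (expR (n%:R * d) ^+ k.+1)).
  rewrite ler_pXn2r ?nnegrE ?expR_ge0//; last by rewrite mulr_ge0// ltW.
  by have := expR_ge1Dx (n%:R * d); lra.
rewrite -expRM_natl le_eqVlt; apply/orP; left; apply/eqP; congr expR.
by rewrite mulrCA; congr (_ * _); rewrite /d mulrC divfK ?pnatr_eq0.
Qed.

Lemma near_expN_le c e : 0 < c -> 0 < e -> \forall n \near \oo, expR (- (n%:R * c)) <= e.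
Proof.
move=> c0 e0; have := near_pow_le_exp 0 e^-1 c0; apply: filterS => n.
rewrite expr0 mulr1 expRN => h.
by rewrite -[leRHS]invrK lef_pV2// posrE ?expR_gt0 ?invr_gt0.
Qed.

End asymptotics.

(** * Upper bounds: strong converse, resolvability above capacity, identification against
    resolvability *)

Section transmission_converse.
Context {R : realType}.
Variables (P N : R).
Hypotheses (P0 : 0 < P) (N0 : 0 < N).
Notation C := (capacity P N).

Lemma le_expR_of_rate n (a : R) M : (0 < n)%N -> (0 < M)%N ->
  a <= n%:R^-1 * ln M%:R -> expR (n%:R * a) <= M%:R.
Proof.
move=> n0 M0; rewrite mulrC ler_pdivlMr ?ltr0n// => h.
by rewrite -[leRHS]lnK ?posrE ?ltr0n// ler_expR mulrC.
Qed.

Lemma expR_le_of_rate n (a : R) M : (0 < n)%N -> (0 < M)%N ->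
  n%:R^-1 * ln M%:R <= a -> M%:R <= expR (n%:R * a).
Proof.
move=> n0 M0; rewrite mulrC ler_pdivrMr ?ltr0n// => h.
by rewrite -[leLHS]lnK ?posrE ?ltr0n// ler_expR mulrC.
Qed.

Lemma tcode_rate_le eps r : eps < 1 -> tcode_achievable N P eps r -> r <= C.
Proof.
move=> eps1 [M [enc [dec [code [herr hrate]]]]].
rewrite leNgt; apply/negP => Cr.
(* Eventually M >= exp(n (C + 2 g)), so both loss terms of [tcode_converse] fall below e. The error
   is then at least 1 - 2 e, against the upper bound eps + e = 1 - 3 e. *)
pose g := (r - C) / 3; pose e := (1 - eps) / 4.
have g0 : 0 < g by rewrite divr_gt0// subr_gt0.
have e0 : 0 < e by rewrite divr_gt0// subr_gt0.
have h1 : (limn_esup (fun n => tcode_err N (enc n) (dec n)) < (eps + e)%:E)%E.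
  by apply: (le_lt_trans herr); rewrite lte_fin ltrDl.
have h2 : ((C + 2 * g)%:E < limn_einf (fun n => (n%:R^-1 * ln (M n)%:R)%:E))%E.
  by apply: lt_le_trans hrate; rewrite lte_fin /g; lra.
have {}h1 := limn_esup_near h1; have {}h2 := limn_einf_near h2.
have g20 : 0 < g ^+ 2 / 2 by rewrite divr_gt0// exprn_gt0.
have h3 := near_expN_le g20 e0; have h4 := near_expN_le g0 e0.
have [n [n0 [k1 [k2 [k3 k4]]]]] : exists n, (0 < n)%N /\
    (tcode_err N (enc n) (dec n) <= (eps + e)%:E)%E /\
    ((C + 2 * g)%:E <= (n%:R^-1 * ln (M n)%:R)%:E)%E /\
    expR (- (n%:R * (g ^+ 2 / 2))) <= e /\ expR (- (n%:R * g)) <= e.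
  near \oo => n; exists n; split; first by near: n; exact: nbhs_infty_gt.
  split; first by near: n.
  split; first by near: n.
  by split; near: n.
(* The decoder is a total map, so its value at one point exhibits a message. *)
have M0 : (0 < M n)%N by case: (M n) (dec n (tzero n)) => // -[].
have Mn := le_expR_of_rate n0 M0 k2.
have := le_trans (tcode_converse P0 N0 (code n) M0 g0) k1.
rewrite lee_fin -[n%:R * g ^+ 2 / 2]mulrA.
have k5 : expR (n%:R * (C + g)) / (M n)%:R <= e.
  apply: le_trans k4; rewrite ler_pdivrMr ?ltr0n//.
  apply: le_trans (ler_wpM2l (expR_ge0 _) Mn); rewrite -expRD ler_expR; lra.
have : eps = 1 - 4 * e by rewrite /e; field.
move=> h5 h6; suff : 1 < 1 :> R by rewrite ltxx.
lra.
Unshelve. all: by end_near. Qed.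

Lemma res_achievable_gt_capacity delta r : 0 <= delta -> C < r -> res_achievable N P delta r.
Proof.
move=> d0 Cr X XP.
(* One g is for the tail, a second makes M exceed exp(n (C + g)) by the factor exp(n g), and the
   third absorbs the factor 2 lost in rounding M to an integer. *)
pose g := (r - C) / 3; have g0 : 0 < g by rewrite divr_gt0// subr_gt0.
pose M n := (Num.trunc (expR (n%:R * (C + 2 * g)))).+1.
have M0 n : (0 < M n)%N by [].
have sc n : exists phi : 'I_(M n) -> n.-tuple R, (forall i, Xn P n (phi i)) /\
  (vdist (QW N (X n)) (unif_out N phi) <=
    (2 * (expR (- (n%:R * g ^+ 2 / 2)) + Num.sqrt (2 * expR (n%:R * (C + g)) / (M n)%:R)))%:E)%E.
  by apply: soft_covering.
exists M, (fun n => sval (cid (sc n))); split => //; split.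
  by move=> n i; case: (cid (sc n)) => phi [phiX ?] /=; exact: phiX.
have Mge n : expR (n%:R * (C + 2 * g)) <= (M n)%:R by apply: ltW; exact: truncnS_gt.
have Mle n : (M n)%:R <= expR (n%:R * (C + 2 * g)) + 1.
  rewrite /M -[leLHS]natr1 lerD2r; by have /andP[] := truncn_itv (expR_ge0 (n%:R * (C + 2 * g))).
split.
- apply: limn_esup_le => e e0.
  have g20 : 0 < g ^+ 2 / 2 by rewrite divr_gt0// exprn_gt0.
  have e4 : 0 < e / 4 by rewrite divr_gt0.
  have e32 : 0 < (e / 4) ^+ 2 / 2 by rewrite divr_gt0// exprn_gt0.
  apply: filterS2 (near_expN_le g20 e4) (near_expN_le g0 e32) => n k1 k2.
  case: (cid (sc n)) => phi [_ phid] /=; apply: (le_trans phid); rewrite lee_fin.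
  have k3 : Num.sqrt (2 * expR (n%:R * (C + g)) / (M n)%:R) <= e / 4.
    rewrite -[leRHS](ger0_norm (ltW e4)) -sqrtr_sqr.
    apply: ler_wsqrtr; rewrite ler_pdivrMr ?ltr0n//.
    apply: le_trans (ler_wpM2l (sqr_ge0 _) (Mge n)).
    have -> : n%:R * (C + 2 * g) = n%:R * (C + g) + n%:R * g by ring.
    move: k2; rewrite expRN -[X in X <= _]mul1r ler_pdivrMr ?expR_gt0// => k2.
    rewrite expRD; have := expR_gt0 (n%:R * (C + g)); nra.
  rewrite -[n%:R * g ^+ 2 / 2]mulrA; lra.
- apply: limn_esup_le => e e0.
  apply: filterS2 (near_natr (ln 2 / g)) (nbhs_infty_gt 0) => n k1 n0.
  rewrite lee_fin mulrC ler_pdivrMr ?ltr0n//.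
  have hx : 1 <= expR (n%:R * (C + 2 * g)).
    rewrite -[leLHS]expR0 ler_expR mulr_ge0//.
    have h0 : 0 <= capacity P N.
      by rewrite /capacity mulr_ge0 ?invr_ge0// ln_ge0// lerDl divr_ge0// ltW.
    lra.
  apply: (@le_trans _ _ (ln (2 * expR (n%:R * (C + 2 * g))))).
    rewrite ler_ln ?posrE ?ltr0n// ?mulr_gt0 ?expR_gt0//.
    by apply: (le_trans (Mle n)); lra.
  rewrite lnM ?posrE ?expR_gt0// expRK.
  move: k1; rewrite ler_pdivrMr// => k1.
  have ne : 0 <= e * n%:R by rewrite mulr_ge0// ltW.
  have -> : (r + e) * n%:R = n%:R * (C + 2 * g) + n%:R * g + e * n%:R by rewrite /g; field.
  lra.
Qed.

(** Resolvability is granted process by process, with no uniformity over the messages of a code,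
    while the counting needs good codes for all messages at the same n. A process that picks at each
    n a message which is good only if all are good bridges the gap. *)
Lemma id_rate_le delta mu lam r r' : mu + lam + delta < 1 ->
  res_achievable N P delta r -> idcode_achievable N P mu lam r' -> r' <= r.
Proof.
move=> sum1 res [K [Q [D [K0 [code [hmu [hlam hrate]]]]]]].
rewrite leNgt; apply/negP => rr'.
(* The identification rate is kept above r + 2 g and the resolvability rate below r + g, so the
   factor exp(n g) is left to beat a polynomial. Of the five shares e, one each goes to mu, lam,
   delta and the quantization; the last keeps the inequality strict. *)
pose g := (r' - r) / 3; have g0 : 0 < g by rewrite divr_gt0// subr_gt0.
pose e := (1 - (mu + lam + delta)) / 5.
have e0 : 0 < e by rewrite divr_gt0// subr_gt0.
have [a a0 quant] := input_quantization P0 N0 e0.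
pose good n (i : 'I_(K n)) := exists M (phi : 'I_M -> n.-tuple R),
  [/\ (0 < M)%N, M%:R <= expR (n%:R * (r + g)),
      forall k, Xn P n (phi k) & (vdist (QW N (Q n i)) (unif_out N phi) <= (delta + e)%:E)%E].
(* The worst codeword of each code forms an input process. *)
have worst n : exists i : 'I_(K n), good n i -> forall j, good n j.
  have [[i ngi]|allg] := pselect (exists i, ~ good n i).
    by exists i.
  by exists (Ordinal (K0 n)) => _ j; apply: contrapT => ngj; apply: allg; exists j.
pose X n := Q n (sval (cid (worst n))).
have XP : input_process P X by move=> n; have [QX _] := code n; exact: QX.
have [M [phi [M0 [phiX [hd hM]]]]] := res X XP.
have hd' : (limn_esup (fun n => vdist (QW N (X n)) (unif_out N (phi n))) < (delta + e)%:E)%E.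
  by apply: (le_lt_trans hd); rewrite lte_fin ltrDl.
have hM' : (limn_esup (fun n => (n%:R^-1 * ln (M n)%:R)%:E) < (r + g)%:E)%E.
  by apply: (le_lt_trans hM); rewrite lte_fin ltrDl.
have hmu' : (limn_esup (fun n => id_mu N (Q n) (D n)) < (mu + e)%:E)%E.
  by apply: (le_lt_trans hmu); rewrite lte_fin ltrDl.
have hlam' : (limn_esup (fun n => id_lambda N (Q n) (D n)) < (lam + e)%:E)%E.
  by apply: (le_lt_trans hlam); rewrite lte_fin ltrDl.
have hrate' : ((r + 2 * g)%:E < limn_einf (fun n => (n%:R^-1 * ln (ln (K n)%:R))%:E))%E.
  by apply: lt_le_trans hrate; rewrite lte_fin /g; lra.
have {}hd := limn_esup_near hd'; have {}hM := limn_esup_near hM'.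
have {}hmu := limn_esup_near hmu'; have {}hlam := limn_esup_near hlam'.
have {}hrate := limn_einf_near hrate'.
(* The count gives ln K <= E (a + 1) n^3: n coordinates with logarithms of at most a n^2 each, for
   at most E points, plus the choice of the size. The constant a + 2 makes the contradiction
   strict. *)
have hpow := near_pow_le_exp 3 (a + 2) g0.
have [n [n0 [k1 [k2 [k3 [k4 [k5 k6]]]]]]] : exists n, (0 < n)%N /\
    (vdist (QW N (X n)) (unif_out N (phi n)) <= (delta + e)%:E)%E /\
    ((n%:R^-1 * ln (M n)%:R)%:E <= (r + g)%:E)%E /\
    (id_mu N (Q n) (D n) <= (mu + e)%:E)%E /\
    (id_lambda N (Q n) (D n) <= (lam + e)%:E)%E /\
    ((r + 2 * g)%:E <= (n%:R^-1 * ln (ln (K n)%:R))%:E)%E /\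
    (a + 2) * n%:R ^+ 3 <= expR (n%:R * g).
  near \oo => n; exists n; split; first by near: n; exact: nbhs_infty_gt.
  split; first by near: n.
  split; first by near: n.
  split; first by near: n.
  split; first by near: n.
  by split; near: n.
have n0' : 0 < n%:R :> R by rewrite ltr0n.
rewrite lee_fin in k2; rewrite lee_fin in k5.
have MnE := expR_le_of_rate n0 (M0 n) k2.
have rg0 : 0 <= r + g.
  by apply: le_trans k2; rewrite mulr_ge0 ?invr_ge0// ln_ge0// ler1n.
set E := expR (n%:R * (r + g)) in MnE.
have E0 : 0 < E by exact: expR_gt0.
pose L := Num.trunc E.
have /andP[LE EL] := truncn_itv (ltW E0); rewrite -/L in LE EL.
have allgood : forall j, good n j.
  apply: (svalP (cid (worst n))); exists (M n), (phi n); split => //.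
have [A [c [Aa cP]]] := quant n n0.
have Kle : (K n <= L.+1 * ((A.+1 ^ n) ^ L))%N.
  apply: (id_counting N0 (code n) k3 k4 cP (d := (delta + e) / 2)) => [i|].
    have [Mi [phii [Mi0 MiE phiiX phiid]]] := allgood i.
    exists Mi, phii; split => //; first by rewrite -ltnS -(ltr_nat R) (le_lt_trans MiE).
    by rewrite mulrC divfK.
  have : 5 * e = 1 - (mu + lam + delta) by rewrite /e; field.
  lra.
have lnKle : ln (K n)%:R <= E * ((a + 1) * n%:R ^+ 3) :> R.
  apply: (@le_trans _ _ (ln (L.+1 * ((A.+1 ^ n) ^ L))%:R)).
    by rewrite ler_ln ?posrE ?ltr0n ?K0 ?ler_nat// muln_gt0/= !expn_gt0.
  rewrite natrM !natrX lnM ?posrE ?exprn_gt0// lnXn ?exprn_gt0// lnXn//.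
  have hL : ln L.+1%:R <= L%:R :> R.
    by apply: (le_trans (ln_le_sub1 _)) => //; rewrite -natr1 addrK.
  have hA : ln A.+1%:R <= a * n%:R ^+ 2 :> R.
    apply: le_trans Aa; apply: (le_trans (ln_le_sub1 _)) => //.
    by rewrite lerBlDr lerDl.
  rewrite -[(_ *+ n) *+ L]mulr_natl -[_ *+ n]mulr_natl.
  have n1 : 1 <= n%:R ^+ 3 :> R by rewrite exprn_ege1// ler1n.
  apply: (@le_trans _ _ (L%:R * ((a + 1) * n%:R ^+ 3))); last first.
    by rewrite ler_wpM2r// mulr_ge0 ?exprn_ge0// addr_ge0// ltW.
  have -> : (a + 1) * n%:R ^+ 3 = n%:R * (a * n%:R ^+ 2) + n%:R ^+ 3 by ring.
  rewrite mulrDr addrC; apply: lerD; last by apply: (le_trans hL); rewrite ler_peMr.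
  by rewrite ler_wpM2l// ler_wpM2l// ltW.
have big : E * ((a + 2) * n%:R ^+ 3) <= ln (K n)%:R.
  apply: (@le_trans _ _ (expR (n%:R * (r + 2 * g)))).
    have -> : n%:R * (r + 2 * g) = n%:R * (r + g) + n%:R * g by ring.
    by rewrite expRD ler_wpM2l// ltW.
  have h : n%:R * (r + 2 * g) <= ln (ln (K n)%:R).
    by rewrite -(ler_pM2l (_ : 0 < n%:R^-1)) ?invr_gt0// mulrA mulVf ?gt_eqF// mul1r.
  have p : 0 < n%:R * (r + 2 * g) by rewrite mulr_gt0//; lra.
  (* [ln] is 0 on nonpositive reals, so K = 1 gives the value 0 for the double logarithm. It is
     excluded by [p], which is positive because [M n] is at least 1 and so r + g >= 0. *)
  have [lK|lK] := ltP 0 (ln (K n)%:R : R).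
    by rewrite -[leRHS]lnK ?posrE// ler_expR.
  by move: h; rewrite (ln0 lK) leNgt p.
have := le_trans big lnKle; rewrite ler_pM2l// ler_pM2r ?exprn_gt0// => h5.
suff : 1 < 1 :> R by rewrite ltxx.
lra.
Unshelve. all: by end_near. Qed.

End transmission_converse.

(** * Transmission codes at rates below capacity *)

Section transmission_direct.
Context {R : realType}.
Variables (P N : R).
Hypotheses (P0 : 0 < P) (N0 : 0 < N).
Notation awgn := (awgn N).
Notation C := (capacity P N).

Definition max_code n M (e : R) (x : nat -> n.-tuple R) (D : nat -> set (n.-tuple R)) : Prop :=
  [/\ forall i, (i < M)%N -> Xn P n (x i),
      forall i, measurable (D i),
      forall i, (i < M)%N -> pr (awgn (x i)) (~` D i) <= e &
      trivIset `I_M D].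

Lemma capacity_gt0 (P' : R) : 0 < P' -> 0 < capacity P' N.
Proof. by move=> P'0; rewrite /capacity mulr_gt0// ln_gt0// ltrDl divr_gt0. Qed.

(** [N * (expR (2 * r) - 1)] is the power at which the capacity equals r; together with
    [capacity_gt] this leaves room for a power P' strictly between it and P. *)
Lemma capacity_lt (P' r : R) : 0 < P' -> N * (expR (2 * r) - 1) < P' -> r < capacity P' N.
Proof.
move=> P'0 h; rewrite /capacity -(ltr_pM2l (_ : 0 < 2))// mulrA divff// mul1r.
rewrite -ltr_expR lnK ?posrE ?addr_gt0 ?divr_gt0//.
by rewrite -ltrBlDl ltr_pdivlMr// mulrC.
Qed.

Lemma capacity_gt (r : R) : r < C -> N * (expR (2 * r) - 1) < P.
Proof.
rewrite /capacity -(ltr_pM2l (_ : 0 < 2))// mulrA divff// mul1r.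
move=> h; have : expR (2 * r) < 1 + P / N.
  by rewrite -[ltRHS]lnK ?posrE ?addr_gt0 ?divr_gt0// ltr_expR.
by rewrite -ltrBlDl ltr_pdivlMr// mulrC.
Qed.

Lemma max_codes_exist (r : R) : 0 < r -> r < C -> exists2 k : R, 0 < k &
  \forall n \near \oo, exists x D,
    @max_code n (Num.trunc (expR (n%:R * r))).+1 (4 * expR (- (n%:R * k))) x D.
Proof.
move=> r0 rC.
pose Q := N * (expR (2 * r) - 1); have QP : Q < P by exact: capacity_gt.
have Q0 : 0 < Q.
  by rewrite mulr_gt0// subr_gt0 -[ltLHS]expR0 ltr_expR mulr_gt0.
pose P' := (Q + P) / 2.
have P'0 : 0 < P' by rewrite divr_gt0// addr_gt0.
have QP' : Q < P' by rewrite /P'; lra.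
have P'P : P' < P by rewrite /P'; lra.
have rC' : r < capacity P' N by exact: capacity_lt.
(* The cap 1 is a hypothesis of [idens_lower_tail]. The margin 3 g between r and the capacity of P'
   leaves 2 g after the threshold is lowered by g, enough to dominate k <= g. *)
pose g := Num.min 1 ((capacity P' N - r) / 3).
have g0 : 0 < g by rewrite lt_min ltr01 divr_gt0// subr_gt0.
have g1 : g <= 1 by rewrite ge_min lexx.
have gr : 3 * g <= capacity P' N - r.
  have : g <= (capacity P' N - r) / 3 by rewrite ge_min lexx orbT.
  lra.
have [q q0 tail] := gin_power_tail P0 P'0 P'P.
pose k := g ^+ 2 / 4.
have k0 : 0 < k by rewrite divr_gt0// exprn_gt0.
have kg : k <= g by rewrite /k; nra.
exists k => //.
have e8 : 0 < 8^-1 :> R by rewrite invr_gt0.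
apply: filterS (near_expN_le q0 e8) => n hq.
have n0 : 0 <= n%:R :> R by [].
(* In units of exp(- n k), the used-up output measure costs at most 2, the lower tail 1, and the
   power violation 4/8. The sum 3.5 is below the error 4. *)
apply: (@feinstein _ P N N0 n P' (n%:R * (capacity P' N - g)) _
   (expR (- (n%:R * k))) (expR (- (n%:R * q)))) => //.
- by rewrite /k mulrA; exact: idens_lower_tail.
set e := expR (- (n%:R * k)).
have eg0 : 0 < e by exact: expR_gt0.
have hM : (Num.trunc (expR (n%:R * r))).+1%:R <= 2 * expR (n%:R * r).
  rewrite -[leLHS]natr1; have /andP[h _] := truncn_itv (expR_ge0 (n%:R * r)).
  have : 1 <= expR (n%:R * r) by rewrite -[leLHS]expR0 ler_expR mulr_ge0// ltW.
  lra.
have h1 : (Num.trunc (expR (n%:R * r))).+1%:R * expR (- (n%:R * (capacity P' N - g))) <= 2 * e.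
  apply: (le_trans (ler_wpM2r (expR_ge0 _) hM)).
  rewrite -mulrA -expRD ler_pM2l// ler_expR.
  have := ler_wpM2l n0 gr; have := ler_wpM2l n0 kg.
  have : 0 <= n%:R * g by rewrite mulr_ge0// ltW.
  lra.
have h2 : expR (- (n%:R * q)) * (4 * e) <= 8^-1 * (4 * e).
  by rewrite ler_wpM2r// mulr_ge0// ltW.
lra.
Qed.

(** Outputs outside every decoding set are sent to message 0. Only the fibre of 0 is thereby
    enlarged, by the complement of a finite union. *)
Lemma exists_decoder n M (D : nat -> set (n.-tuple R)) :
  (forall i, measurable (D i)) -> trivIset `I_M.+1 D ->
  exists dec : n.-tuple R -> 'I_M.+1, forall i : 'I_M.+1,
    measurable (dec @^-1` [set i]) /\ D i `<=` dec @^-1` [set i].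
Proof.
move=> mD tD.
pose dec y : 'I_M.+1 :=
  if pselect (exists i : 'I_M.+1, D i y) is left h then sval (cid h) else ord0.
have decD (i : 'I_M.+1) : D i `<=` dec @^-1` [set i].
  move=> y Dy; rewrite /dec /=; case: pselect => [h|[]]; last by exists i.
  apply/val_inj; apply: (tD _ _ (ltn_ord _) (ltn_ord _)); exists y; split => //.
  by case: (cid h).
exists dec => i; split; last exact: decD.
pose U := \big[setU/set0]_(j < M.+1) D j.
have mU : measurable U by apply: bigsetU_measurable.
have [i0|i0] := eqVneq i ord0.
  rewrite (_ : dec @^-1` _ = D i `|` ~` U); first by apply: measurableU => //; exact: measurableC.
  apply/seteqP; split => y /=.
    rewrite /dec; case: pselect => [h <-|h _].
      by left; case: (cid h).
    by right; rewrite /U -(bigcup_mkord M.+1 D) => -[j /= jM Dj]; apply: h; exists (Ordinal jM).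
  move=> [/decD//|Uy]; rewrite /dec; case: pselect => // h; exfalso; apply: Uy.
  by case: h => j Dj; rewrite /U -(bigcup_mkord M.+1 D); exists j => //=.
rewrite (_ : dec @^-1` _ = D i) => //; apply/seteqP; split; last exact: decD.
move=> y /=; rewrite /dec; case: pselect => [h <-|_ i0']; first by case: (cid h).
by move: i0; rewrite -i0' eqxx.
Qed.

Lemma tzero_Xn n : Xn P n (tzero n).
Proof.
rewrite /Xn/= big1 ?mulr0 ?ltW// => i _.
by rewrite tnth_nseq expr0n.
Qed.

Lemma tcode_achievable_lt_capacity eps r : 0 <= eps -> 0 < r -> r < C ->
  tcode_achievable N P eps r.
Proof.
move=> eps0 r0 rC; have [k k0 codes] := max_codes_exist r0 rC.
pose good n := exists x D,
  @max_code n (Num.trunc (expR (n%:R * r))).+1 (4 * expR (- (n%:R * k))) x D.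
(* Good codes exist only for large n; a code with one message fills in elsewhere. The dependent pair
   lets the size and the code be chosen at once for every n. *)
have H n : exists s : {M : nat & (('I_M -> n.-tuple R) * (n.-tuple R -> 'I_M))%type},
   is_tcode P (projT2 s).1 (projT2 s).2 /\
   (good n -> [/\ expR (n%:R * r) <= (projT1 s)%:R &
      (tcode_err N (projT2 s).1 (projT2 s).2 <= (4 * expR (- (n%:R * k)))%:E)%E]).
  have [[x [D [xX mD eD tD]]]|nogood] := pselect (good n); last first.
    exists (existT _ 1%N ((fun=> tzero n), (fun=> ord0))); split => //=; split.
      by move=> _; exact: tzero_Xn.
    move=> i; rewrite (_ : _ @^-1` _ = setT)//.
    by apply/seteqP; split => // y _ /=; rewrite !ord1.
  set M := (Num.trunc _).+1 in xX eD tD.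
  have [dec decP] := exists_decoder mD tD.
  have code : is_tcode P (fun i : 'I_M => x i) dec.
    by split => [i|i]; [exact: xX|have [] := decP i].
  exists (existT _ M ((fun i : 'I_M => x i), dec)); split => //= _; split.
    by apply: ltW; exact: truncnS_gt.
  rewrite (tcode_err_pr N0 code) lee_fin mulrC ler_pdivrMr ?ltr0n//.
  apply: (@le_trans _ _ (\sum_(i < M) (4 * expR (- (n%:R * k))))); last first.
    by rewrite sumr_const card_ord mulr_natr.
  apply: ler_sum => i _; have [mdec Ddec] := decP i.
  rewrite -prC//; apply: le_trans (eD i (ltn_ord i)).
  by apply: le_pr; [exact: measurableC|exact: measurableC|exact: subsetC].
exists (fun n => projT1 (sval (cid (H n)))), (fun n => (projT2 (sval (cid (H n)))).1),
  (fun n => (projT2 (sval (cid (H n)))).2); split.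
  by move=> n; have [] := svalP (cid (H n)).
split.
  apply: limn_esup_le => e e0; have e4 : 0 < e / 4 by rewrite divr_gt0.
  apply: filterS2 codes (near_expN_le k0 e4) => n gn he.
  have [_ /(_ gn)[_ herr]] := svalP (cid (H n)).
  apply: (le_trans herr); rewrite lee_fin; lra.
apply: limn_einf_ge; apply: filterS2 codes (nbhs_infty_gt 0) => n gn n0.
have [_ /(_ gn)[hM _]] := svalP (cid (H n)).
rewrite lee_fin mulrC ler_pdivlMr ?ltr0n// mulrC.
have M0 : (0 < projT1 (sval (cid (H n))))%N.
  by rewrite -(ltr_nat R); apply: lt_le_trans hM; exact: expR_gt0.
by rewrite -ler_expR lnK// posrE ltr0n.
Qed.

End transmission_direct.

(** * Identification codes from transmission codes *)

Section gilbert_varshamov.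
Variables (m l : nat).
Let L := (4 ^ l)%N.
Let word := {ffun 'I_m -> 'I_L}.
Local Open Scope set_scope.
Local Open Scope nat_scope.

Definition agree (f g : word) : {set 'I_m} := [set k | f k == g k].

Lemma card_agree_on (f : word) (S : {set 'I_m}) :
  #|[set g : word | S \subset agree f g]| * L ^ #|S| = L ^ m.
Proof.
pose F (k : 'I_m) : pred 'I_L := if k \in S then pred1 (f k) else predT.
have -> : #|[set g : word | S \subset agree f g]| = \prod_(k < m) (if k \in S then 1 else L).
  rewrite (eq_card (B := family F)) ?card_family.
    rewrite foldrE big_map big_enum/=; apply: eq_bigr => k _.
    by rewrite /F; case: ifP; rewrite ?card1// card_ord.
  move=> g; rewrite inE; apply/fintype.subsetP/familyP => [h k|h k kS].
    rewrite /F; case: ifPn => // /h; rewrite inE => /eqP e.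
    by rewrite inE e.
  by have := h k; rewrite /F kS inE eq_sym => e; rewrite inE.
have -> : L ^ #|S| = \prod_(k < m) (if k \in S then L else 1).
  by rewrite -big_mkcond/= prod_nat_const.
rewrite -big_split/= -[in RHS](card_ord m) -prod_nat_const.
by apply: eq_bigr => k _; case: ifP; rewrite ?mul1n ?muln1.
Qed.

(** A union bound over the agreement sets S with l |S| >= m, for each of which at most L^m / L^|S|
    words remain. The alphabet size L = 4^l makes L^|S| at least 4^m: one factor 2^m pays for the
    number of sets S, the other leaves room for 2^m codewords. *)
Lemma card_agree_often (f : word) : #|[set g : word | m <= l * #|agree f g|]| * 2 ^ m <= L ^ m.
Proof.
rewrite -(leq_pmul2r (expn_gt0 2 m : 0 < 2 ^ m)) -mulnA -expnMn.
rewrite -sum1_card.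
rewrite (partition_big (agree f) (fun S => m <= l * #|S|)); last by move=> g; rewrite inE.
rewrite big_distrl/=.
apply: (@leq_trans (\sum_(S : {set 'I_m} | m <= l * #|S|) L ^ m)).
  apply: leq_sum => S mS; rewrite sum1_card.
  apply: (@leq_trans (#|[set g : word | S \subset agree f g]| * L ^ #|S|)); last first.
    by rewrite card_agree_on.
  apply: leq_mul.
    by apply: subset_leq_card; apply/fintype.subsetP => g; rewrite !inE => /andP[_ /eqP <-].
  by rewrite -expnM leq_exp2l.
rewrite sum_nat_const mulnC leq_mul2l; apply/orP; right.
apply: (leq_trans (max_card _)).
by rewrite -cardsT -powersetT card_powerset cardsT card_ord.
Qed.

(* Below 2 ^ m codewords, the words agreeing too often with one of them do not
   exhaust the space, so one more can be chosen. *)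
Lemma gilbert_varshamov K : K <= 2 ^ m -> exists F : nat -> word,
  forall i j, i < K -> j < K -> i != j -> l * #|agree (F i) (F j)| < m.
Proof.
have L0 : 0 < L by rewrite expn_gt0.
elim: K => [_|K IH K2m]; first by exists (fun=> [ffun=> Ordinal L0]).
have [F FP] := IH (ltnW K2m).
have [g gP] : exists g : word, forall i, i < K -> l * #|agree (F i) g| < m.
  apply/not_existsP => nog.
  have : #|{: word}| <= \sum_(i < K) #|[set g : word | m <= l * #|agree (F i) g|]|.
    rewrite -sum1_card.
    under [leqRHS]eq_bigr do rewrite -sum1_card big_mkcond/=.
    rewrite exchange_big/=; apply: leq_sum => g _.
    have /existsNP[i /not_implyP[iK /negP]] := nog g; rewrite -leqNgt => bad.
    by rewrite (bigD1 (Ordinal iK))//= inE bad.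
  rewrite leqNgt => /negP; apply.
  rewrite -(ltn_pmul2r (expn_gt0 2 m : 0 < 2 ^ m)) big_distrl/=.
  apply: (@leq_ltn_trans (\sum_(i < K) L ^ m)).
    by apply: leq_sum => i _; exact: card_agree_often.
  rewrite sum_nat_const card_ord card_ffun !card_ord mulnC ltn_pmul2l//.
  by rewrite expn_gt0 L0.
exists (fun i => if i == K then g else F i) => i j iK jK.
have ltK k : k < K.+1 -> k != K -> k < K by rewrite ltnS leq_eqVlt => /orP[->|].
have sym (a b : word) : agree a b = agree b a.
  by apply/setP => k; rewrite !inE eq_sym.
case: (eqVneq i K) => [->|iK']; case: (eqVneq j K) => [jE|jK'].
- by rewrite ?jE ?eqxx.
- by move=> _; rewrite sym; apply: gP; exact: ltK.
- by move=> _; apply: gP; exact: ltK.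
- by apply: FP; exact: ltK.
Qed.

End gilbert_varshamov.

Section uniform_on_points.
Context d (T : measurableType d) (R : realType) (m : nat) (p : nat -> T).
Local Open Scope ereal_scope.

Lemma inv_natS_ge0 : (0 <= m.+1%:R^-1 :> R)%R. Proof. by rewrite invr_ge0. Qed.

Definition unif_points : set T -> \bar R :=
  mscale (NngNum inv_natS_ge0) (msum (fun k => \d_(p k)) m.+1).

HB.instance Definition _ := Measure.on unif_points.

Lemma integral_unif_points (f : T -> \bar R) : measurable_fun setT f -> (forall x, 0 <= f x) ->
  \int[unif_points]_x f x = (m.+1%:R^-1)%:E * \sum_(k < m.+1) f (p k).
Proof.
move=> mf f0; rewrite ge0_integral_mscale// ge0_integral_measure_sum//.
by congr (_ * _); apply: eq_bigr => k _; rewrite integral_dirac// diracT mul1e.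
Qed.

Let unif_points_setT : unif_points setT = 1.
Proof.
rewrite /unif_points /mscale/= /msum/=.
rewrite (eq_bigr (fun=> 1)); last by move=> k _; rewrite diracT.
by rewrite sumEFin big_const_ord iter_addr_0 -EFinM mulVf// pnatr_eq0.
Qed.

HB.instance Definition _ := Measure_isProbability.Build _ _ _ unif_points unif_points_setT.

End uniform_on_points.

(** * Identification codes at rates below capacity *)

Section identification_direct.
Context {R : realType}.
Variables (P N : R).
Hypotheses (P0 : 0 < P) (N0 : 0 < N).
Notation awgn := (awgn N).
Notation C := (capacity P N).

Lemma QW_unif_points n m (p : nat -> n.-tuple R) B : measurable B ->
  QW N (unif_points R m p) B = (m.+1%:R^-1 * \sum_(k < m.+1) pr (awgn (p k)) B)%:E.
Proof.
move=> mB; rewrite QW_awgn// integral_unif_points//; last exact: measurable_awgn.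
by rewrite EFinM -sumEFin; congr (_ * _)%E; apply: eq_bigr => k _; rewrite prE.
Qed.

Lemma unif_points_eq1 n m (p : nat -> n.-tuple R) B : measurable B ->
  (forall k, (k < m.+1)%N -> B (p k)) -> unif_points R m p B = 1%E.
Proof.
move=> mB pB; rewrite -[X in unif_points _ _ _ X]setIT -integral_indic//.
rewrite integral_unif_points//; last by apply/measurable_EFinP; exact: measurable_indic.
rewrite (eq_bigr (fun=> 1%E)); last first.
  by move=> k _; rewrite indicE mem_set//; exact: pB.
by rewrite sumEFin sumr_const card_ord -EFinM mulVf// pnatr_eq0.
Qed.

Lemma mean_le (a : R) m (F : 'I_m.+1 -> R) : \sum_(k < m.+1) F k <= m.+1%:R * a ->
  m.+1%:R^-1 * \sum_(k < m.+1) F k <= a.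
Proof. by move=> h; rewrite mulrC ler_pdivrMr ?ltr0n// mulrC. Qed.

(* Ahlswede-Dueck: message i uses the uniform distribution on one transmission codeword
   from each of the m.+1 blocks of length 4 ^ l, selected by the word F i; two such
   families overlap in a fraction less than 1 / l. *)
Lemma id_code_of_max_code n M e x D m l K :
  @max_code _ P N n M e x D -> 0 <= e -> (0 < l)%N -> (m.+1 * 4 ^ l <= M)%N ->
  (K <= 2 ^ m.+1)%N ->
  exists (Q : 'I_K -> probability (n.-tuple R) R) (E : 'I_K -> set (n.-tuple R)),
    [/\ is_idcode P Q E, (id_mu N Q E <= e%:E)%E & (id_lambda N Q E <= (e + l%:R^-1)%:E)%E].
Proof.
move=> [xX mD eD tD] e0 l0 mM KM.
have [F FP] := gilbert_varshamov l KM.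
have L0 : (0 < 4 ^ l)%N by rewrite expn_gt0.
pose idx (f : {ffun 'I_m.+1 -> 'I_(4 ^ l)}) (k : nat) : nat := (k * 4 ^ l + f (inord k))%N.
have idxM f k : (k < m.+1)%N -> (idx f k < M)%N.
  move=> km; apply: leq_trans mM; rewrite /idx.
  by apply: (@leq_trans (k.+1 * 4 ^ l)); [rewrite mulSn addnC ltn_add2r|rewrite leq_mul2r km orbT].
have idx_inj f f' (k k' : 'I_m.+1) : idx f k = idx f' k' -> k = k' /\ f k = f' k'.
  rewrite /idx !inord_val => h.
  have kk : k = k'.
    apply/val_inj; move/(congr1 (fun z => z %/ 4 ^ l)%N): h.
    by rewrite !divnMDl// !divn_small// !addn0.
  by split => //; apply/val_inj; move: h; rewrite kk => /addnI.
pose p (i : 'I_K) k := x (idx (F i) k).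
pose E (i : 'I_K) := \big[setU/set0]_(k < m.+1) D (idx (F i) k).
have mE i : measurable (E i) by apply: bigsetU_measurable.
have DE (i : 'I_K) (k : 'I_m.+1) : D (idx (F i) k) `<=` E i.
  move=> y Dy; rewrite /E -(bigcup_mkord m.+1 (fun k => D (idx (F i) k))).
  by exists k => //=.
exists (fun i => unif_points R m (p i)), E; split.
- split => // i; apply: unif_points_eq1; first exact: measurable_Xn.
  by move=> k km; apply: xX; exact: idxM.
- apply: bigmax_le; first by rewrite lee_fin.
  move=> i _; have mC : measurable (~` E i) by exact: measurableC.
  rewrite QW_unif_points// lee_fin; apply: mean_le.
  apply: (@le_trans _ _ (\sum_(k < m.+1) e)); last by rewrite sumr_const card_ord mulr_natl.
  apply: ler_sum => k _; apply: le_trans (eD _ (idxM (F i) k (ltn_ord k))).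
  by apply: le_pr; [exact: mC|exact: measurableC|apply: subsetC; exact: DE].
- have el0 : 0 <= e + l%:R^-1 :> R by rewrite addr_ge0// invr_ge0.
  apply: bigmax_le; first by rewrite lee_fin.
  move=> i _; apply: bigmax_le; first by rewrite lee_fin.
  move=> j ji; rewrite QW_unif_points// lee_fin; apply: mean_le.
  (* On blocks where the two words agree the bound is 1. Elsewhere the codeword of j is not one of
     i, its decoding set is disjoint from [E i], and the bound is e. The proportion of agreements is
     below 1 / l. *)
  pose a (k : 'I_m.+1) : R := (F i k == F j k)%:R.
  have ha : \sum_(k < m.+1) a k <= m.+1%:R * l%:R^-1.
    rewrite ler_pdivlMr ?ltr0n//.
    have -> : \sum_(k < m.+1) a k = #|agree (F i) (F j)|%:R.
      rewrite -sum1_card natr_sum [RHS]big_mkcond/=; apply: eq_bigr => k _.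
      by rewrite /a inE; case: (_ == _).
    rewrite -natrM ler_nat mulnC ltnW//; apply: FP => //.
    by rewrite eq_sym; apply: contra ji => /eqP/val_inj ->.
  apply: (@le_trans _ _ (\sum_(k < m.+1) (e + a k))); last first.
    rewrite big_split/= sumr_const card_ord mulrDr; apply: lerD => //.
    by rewrite mulr_natl.
  apply: ler_sum => k _; rewrite /a.
  have [Fk|Fk] := eqVneq (F i k) (F j k).
    by apply: (le_trans (pr_le1 _ (mE i))); rewrite lerDr.
  rewrite addr0; apply: le_trans (eD _ (idxM (F j) k (ltn_ord k))).
  apply: le_pr; [exact: mE|exact: measurableC|].
  move=> y; rewrite /E -(bigcup_mkord m.+1 (fun k => D (idx (F i) k))).
  move=> [k' /= k'm Dy] Dy'.
  have := tD _ _ (idxM (F i) k' k'm) (idxM (F j) k (ltn_ord k)).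
  case/(_ (ex_intro _ y (conj Dy Dy'))).
  move/(@idx_inj (F i) (F j) (Ordinal k'm) k) => [kk' FF].
  by move: Fk; rewrite -{1}kk' FF eqxx.
Qed.

Lemma idcode_achievable_lt_capacity mu lam r : 0 <= mu -> 0 <= lam -> 0 < r -> r < C ->
  idcode_achievable N P mu lam r.
Proof.
move=> mu0 lam0 r0 rC.
(* Transmission runs at a higher rate r1: the number of blocks is smaller than the number of
   codewords by a factor of up to n, which exp(n (r1 - r)) makes up for. *)
pose r1 := (r + C) / 2; have rr1 : r < r1 by rewrite /r1; lra.
have r1C : r1 < C by rewrite /r1; lra.
have r10 : 0 < r1 by apply: lt_trans rr1.
have [k k0 codes] := max_codes_exist P0 N0 r10 r1C.
(* The slowly growing l reconciles two needs: 4^l <= n keeps the blocks short, and l tends to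
   infinity, so that the overlap 1 / l vanishes. *)
pose l n := trunc_log 4 n.
pose en n : R := 4 * expR (- (n%:R * k)).
have en0 n : 0 <= en n by rewrite mulr_ge0// expR_ge0.
pose good n K (Q : 'I_K -> probability (n.-tuple R) R) (E : 'I_K -> set (n.-tuple R)) :=
  [/\ (id_mu N Q E <= (en n)%:E)%E, (id_lambda N Q E <= (en n + (l n)%:R^-1)%:E)%E &
     expR (n%:R * r) <= ln K%:R].
have goodn : \forall n \near \oo, exists K Q E, [/\ (0 < K)%N, is_idcode P Q E & @good n K Q E].
  have d0 : 0 < r1 - r by rewrite subr_gt0.
  have h4 : \forall n \near \oo, (4 <= n)%N by exact: nbhs_infty_ge.
  apply: filterS3 codes (near_pow_le_exp 1 3 d0) h4 => n [x [D code]] hpow n4.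
  have n0 : (0 < n)%N by apply: leq_trans n4.
  have l0 : (0 < l n)%N by apply: trunc_log_max.
  have Ln : (4 ^ l n <= n)%N by exact: trunc_logP.
  set M := (Num.trunc _).+1 in code.
  have MD : expR (n%:R * r1) < M%:R by exact: truncnS_gt.
  pose m := (M %/ 4 ^ l n)%N.
  have e1 : 1 <= expR (n%:R * r) by rewrite -[leLHS]expR0 ler_expR mulr_ge0// ltW.
  have n0' : 0 < n%:R :> R by rewrite ltr0n.
  have mlow : 2 * expR (n%:R * r) <= m%:R.
    have h1 : expR (n%:R * r1) <= (m%:R + 1) * n%:R.
      apply: ltW; apply: (lt_le_trans MD); rewrite natr1 -natrM ler_nat.
      apply: ltnW; apply: (@leq_trans (m.+1 * 4 ^ l n)); last by rewrite leq_mul2l Ln orbT.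
      by apply: ltn_ceil; rewrite expn_gt0.
    have h2 : 3 * expR (n%:R * r) * n%:R <= expR (n%:R * r1).
      have -> : n%:R * r1 = n%:R * r + n%:R * (r1 - r) by ring.
      rewrite expRD mulrAC mulrC ler_wpM2l ?expR_ge0//.
    have := le_trans h2 h1; rewrite ler_pM2r//; lra.
  have m0 : (0 < m)%N.
    by rewrite -(ltr_nat R); apply: lt_le_trans mlow; rewrite mulr_gt0// expR_gt0.
  have mM : (m.-1.+1 * 4 ^ l n <= M)%N by rewrite prednK//; exact: leq_divM.
  have [Q [E [code' hmu hlam]]] :=
    id_code_of_max_code code (en0 n) l0 mM (leqnn _).
  exists (2 ^ m.-1.+1)%N, Q, E; split => //; first by rewrite expn_gt0.
  split => //; rewrite prednK// natrX lnXn//.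
  have := @ln_ge_1subV R 2 ltac:(by []) => hln.
  rewrite -[leRHS]mulr_natl.
  apply: (@le_trans _ _ (m%:R * 2^-1)); first by rewrite ler_pdivlMr// mulrC.
  by rewrite ler_wpM2l//; lra.
have H n : exists s : {K : nat & (('I_K -> probability (n.-tuple R) R) *
     ('I_K -> set (n.-tuple R)))%type},
   [/\ (0 < projT1 s)%N, is_idcode P (projT2 s).1 (projT2 s).2 &
   ((exists K Q E, [/\ (0 < K)%N, is_idcode P Q E & @good n K Q E]) ->
     @good n _ (projT2 s).1 (projT2 s).2)].
  have [[K [Q [E [K0 code gd]]]]|nogood] :=
    pselect (exists K Q E, [/\ (0 < K)%N, is_idcode P Q E & @good n K Q E]).
    by exists (existT _ K (Q, E)); split.
  pose Q1 (i : 'I_1) : probability (n.-tuple R) R := unif_points R 0 (fun=> tzero n).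
  pose E1 (i : 'I_1) : set (n.-tuple R) := setT.
  exists (existT _ 1%N (Q1, E1)); split => //=.
  split=> i; last exact: measurableT.
  have /= h := @unif_points_eq1 n 0 (fun=> tzero n) (Xn P n) (@measurable_Xn _ P n).
  by apply: h => ? _; exact: tzero_Xn.
exists (fun n => projT1 (sval (cid (H n)))), (fun n => (projT2 (sval (cid (H n)))).1),
  (fun n => (projT2 (sval (cid (H n)))).2); split.
  by move=> n; have [] := svalP (cid (H n)).
split; first by move=> n; have [] := svalP (cid (H n)).
have llarge (e : R) : 0 < e -> \forall n \near \oo, (l n)%:R^-1 <= e.
  move=> e0; pose a := (Num.trunc e^-1).+1.
  have : \forall n \near \oo, (4 ^ a <= n)%N by exact: nbhs_infty_ge.
  apply: filterS => n an; have al : (a <= l n)%N by exact: trunc_log_max.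
  rewrite -[leRHS]invrK lef_pV2 ?posrE ?invr_gt0//; last first.
    by rewrite ltr0n; apply: leq_trans al.
  apply: (@le_trans _ _ a%:R); last by rewrite ler_nat.
  by apply: ltW; exact: truncnS_gt.
split; [|split].
- apply: limn_esup_le => e e0; have e4 : 0 < e / 4 by rewrite divr_gt0.
  apply: filterS2 goodn (near_expN_le k0 e4) => n gn he.
  have [_ _ /(_ gn)[h _ _]] := svalP (cid (H n)).
  apply: (le_trans h); rewrite lee_fin /en; lra.
- apply: limn_esup_le => e e0; have e8 : 0 < e / 8 by rewrite divr_gt0.
  have e2 : 0 < e / 2 by rewrite divr_gt0.
  apply: filterS3 goodn (near_expN_le k0 e8) (llarge _ e2) => n gn he hl.
  have [_ _ /(_ gn)[_ h _]] := svalP (cid (H n)).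
  apply: (le_trans h); rewrite lee_fin /en; lra.
apply: limn_einf_ge; apply: filterS2 goodn (nbhs_infty_gt 0) => n gn n0.
have [_ _ /(_ gn)[_ _ h]] := svalP (cid (H n)).
rewrite lee_fin mulrC ler_pdivlMr ?ltr0n// mulrC.
have lK0 := lt_le_trans (expR_gt0 _) h.
by rewrite -ler_expR [leRHS]lnK// posrE.
Qed.

End identification_direct.

Theorem theorem6p3 (R : realType) (P N : R) :
  0 < P -> 0 < N ->
  forall eps delta mu lam : R,
    0 <= eps -> eps < 1 ->
    0 <= delta -> delta < 1 ->
    0 <= mu -> 0 <= lam -> mu + lam < 1 ->
    let c := ((2 : R)^-1 * ln (1 + P / N))%:E in
    Cs N P eps = c /\ Did N P mu lam = c /\ Sres N P delta = c /\ Cs N P 0 = c.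
Proof.
move=> P0 N0 eps delta mu lam eps0 eps1 delta0 delta1 mu0 lam0 ml1 c.
pose C := capacity P N; have C0 : 0 < C by exact: capacity_gt0.
have approx (S : set R) : (forall r, 0 < r -> r < C -> S r) ->
    (forall r, S r -> r <= C) -> ereal_sup [set r%:E | r in S] = C%:E.
  move=> lo hi; apply/eqP; rewrite eq_le; apply/andP; split.
    by apply: ge_ereal_sup => _ [r Sr <-]; rewrite lee_fin; exact: hi.
  apply/lee_subgt0Pr => e e0; rewrite -EFinB.
  (* The term C / 2 keeps the rate positive, as the direct parts require. *)
  pose r := Num.max (C / 2) (C - e).
  apply: (@le_trans _ _ r%:E); first by rewrite lee_fin le_max lexx orbT.
  apply: ereal_sup_ubound; exists r => //; apply: lo.
    by rewrite lt_max divr_gt0.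
  by rewrite gt_max; apply/andP; split; lra.
have CsE e : 0 <= e -> e < 1 -> Cs N P e = C%:E.
  move=> e0 e1; apply: approx => r.
    by move=> r0 rC; exact: tcode_achievable_lt_capacity.
  exact: tcode_rate_le.
split; first exact: CsE.
split; last split; last exact: CsE.
- apply: approx => r; first by move=> r0 rC; exact: idcode_achievable_lt_capacity.
  move=> hr; apply/ler_addgt0Pr => e e0.
  apply: (@id_rate_le _ P N P0 N0 0 mu lam) hr; first by rewrite addr0.
  by apply: res_achievable_gt_capacity => //; rewrite ltrDl.
- apply/eqP; rewrite eq_le; apply/andP; split.
    apply/lee_addgt0Pr => e e0; rewrite -EFinD.
    apply: ereal_inf_lbound; exists (C + e) => //.
    by apply: res_achievable_gt_capacity => //; rewrite ltrDl.
  apply: le_ereal_inf_tmp => _ [r hr <-]; rewrite lee_fin.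
  rewrite leNgt; apply/negP => rC.
  (* The rate r may be negative. With its positive part m, the midpoint of m and C is a positive
     rate below C, achievable for identification and larger than r, against [id_rate_le] with mu =
     lam = 0. *)
  pose m := Num.max r 0.
  have rm : r <= m by rewrite le_max lexx.
  have m0 : 0 <= m by rewrite le_max lexx orbT.
  have mC : m < C by rewrite gt_max rC.
  have h1 : (m + C) / 2 < C by lra.
  have h2 : 0 < (m + C) / 2 by lra.
  have : (m + C) / 2 <= r.
    apply: (@id_rate_le _ P N P0 N0 delta 0 0 r) => //; first by rewrite !add0r.
    exact: idcode_achievable_lt_capacity.
  move=> h3; suff : 1 < 1 :> R by rewrite ltxx.
  lra.
Qed.
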